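(* Let $\{Q_i\}_{i\in\bar\Lambda}$ be a complete set of key polynomials for $\nu$. For $i\in\bar\Lambda$ let $b_i$ be the smallest positive integer $b$ maximizing $\frac{\beta_i-\nu(\partial_bQ_i)}b$, and let $I_{i,max}=\left\{\tilde b\in\mathbb N:\frac{\beta_i-\nu(\partial_{\tilde b}Q_i)}{\tilde b}=\frac{\beta_i-\nu(\partial_{b_i}Q_i)}{b_i}\right\}$. Then for each $i\in\bar\Lambda$ every $\tilde b_i\in I_{i,max}$ is of the form $\tilde b_i=p^{\tilde e_i}$ for some $\tilde e_i\in\mathbb N_0$. In particular, $b_i=p^{e_i}$ for some $e_i\in\mathbb N_0$. In the special case $\operatorname{char}k_\nu=0$ we have $p=1$ and so $I_{i,max}=\{b_i\}=\{1\}$.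
   Context: Setting. $K\subset K(x)$ is a simple transcendental extension, $\nu$ a valuation of $K(x)$ with value group $\Gamma$ and residue field $k_\nu$, $\nu_K=\nu|_K$ with value group $\Gamma_0$; $\operatorname{rank}\nu_K=1$, $\nu(x)>0$. $p=\operatorname{char}k_\nu$ if this is positive, $p=1$ otherwise. $\partial_b$ is the $b$-th Hasse derivative: $f(x+y)=\sum_b\partial_bf(x)y^b$. Convention $\nu(0)=\infty$. $\tilde\Gamma_0=\Gamma_0\otimes_{\mathbb Z}\mathbb Q$, with a fixed ordered embedding into $\mathbb R$; values are compared in $\Gamma\otimes\mathbb Q$. $\mathbb N$ = positive integers, $\mathbb N_0=\mathbb N\cup\{0\}$. $G_\nu=\bigoplus_{\beta\in\Gamma}\mathbf P_\beta/\mathbf P_{\beta+}$ with $\mathbf P_\beta=\{y\in K(x):\nu(y)\ge\beta\}$, $\mathbf P_{\beta+}=\{y:\nu(y)>\beta\}$; $\mathrm{in}_\nu y$ is the class of $y$ in degree $\nu(y)$; $G_{\nu_K}$ is the analogous algebra for $(K,\nu_K)$. For a graded domain $G$, $G^*=\{g/h: g,h\in G,\ h\ne0 \text{ homogeneous}\}$. Index sets. $\Lambda$ is a countable well ordered set with least element $0$; $i+1$ is the successor of $i$, etc. $(\alpha_i)_{i\in\Lambda}$ are positive integers, $\alpha_0=1$. $i$ is inessential if $i+\omega\in\Lambda$ and $\alpha_{i+t}=1$ for all $t\in\mathbb N_0$. For non-maximal $i$, $i+$ denotes $i+\omega$ if $i$ is inessential, and $i+1$ otherwise. Pre-key polynomials: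 monic $Q_i\in K[x]$ $(i\in\Lambda)$, $Q_0=x$, with $\deg Q_i=\alpha_i\deg Q_{i_0}$ for all non-maximal $i\ge1$ and $i_0<i$ with $i_0+=i$. Put $\beta_i=\nu(Q_i)$, $\bar\alpha_i=\deg_xQ_i$, $\mathbf Q_i=\{Q_q\}_{q<i}$. Standard expansions. An $\ell$-standard monomial is $c\prod_{i\le\ell}Q_i^{\gamma_i}$, $c\in K$, $\gamma_i\in\mathbb N_0$ almost all $0$, with $\gamma_i<\alpha_{i+}$ for $i<\ell$ and, for each inessential $i$, at most one $j$ with $j+=i+$ and $\gamma_j\neq0$ (here $i+$ is computed in $\{q\in\Lambda:q\le\ell\}$). It is $Q_\ell$-free if $\gamma_\ell=0$. A $Q_\ell$-free $\ell$-standard expansion is a finite sum of $Q_\ell$-free $\ell$-standard monomials whose $\nu$-value is the minimum of the values of the monomials. An $\ell$-standard expansion of $g\in K[x]$ is $g=\sum_jc_jQ_\ell^j$ with each $c_j$ a $Q_\ell$-free $\ell$-standard expansion. Set of key polynomials for $\nu$: a set of pre-key polynomials such that (a) $\beta_i\in\tilde\Gamma_0$ for $i\ne\max\Lambda$; (b) if $i\ge1$ has an immediate predecessor, $Q_i$ has an $(i-1)$-standard expansion $Q_i=Q_{i-1}^{\alpha_i}+\sum_{j<\alpha_i}\big(\sum_\gamma c_{j,\gamma}M_\gamma\big)Q_{i-1}^j$ where the $c_{j,\gamma}M_\gamma$ are $Q_{i-1}$-free $(i-1)$-standard monomials ($c_{j,\gamma}\in K$, $M_\gamma$ a product of powers of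 elements of $\mathbf Q_{i-1}$; elements of $K$ if $i=1$), all the monomials appearing have the same $\nu$-value, and $(\mathrm{in}_\nu Q_{i-1})^{\alpha_i}+\sum_{j}\big(\sum_\gamma \mathrm{in}_{\nu_K}c_{j,\gamma}\,\mathrm{in}_\nu M_\gamma\big)(\mathrm{in}_\nu Q_{i-1})^j=0$ is the minimal algebraic relation of $\mathrm{in}_\nu Q_{i-1}$ over $G_{\nu_K}[\mathrm{in}_\nu\mathbf Q_{i-1}]^*$; (c) if $i\geq 1$ has no immediate predecessor, there is $i_0$ with $i_0+=i$, and for every such $i_0$ there is an $i_0$-standard expansion $Q_i=\sum_{j=0}^{\alpha_i}c_{j,i_0}Q_{i_0}^j$; every such expansion satisfies $\nu(Q_i)>\min_j\nu(c_{j,i_0}Q_{i_0}^j)$, and $Q_i$ has the smallest degree among polynomials with this property for all $i_0$ with $i_0+=i$; if $\{\beta_{i'}:i'<i\}$ is bounded in $\tilde\Gamma_0$ (in particular if $i\ne\max\Lambda$) then $c_{\alpha_i,i_0}=1$ and $\min_j\nu(c_{j,i_0}Q_{i_0}^j)=\alpha_i\beta_{i_0}=\nu(c_{0,i_0})$; (d) if for some $n$ the set $\{i:\deg Q_i=n\}$ is infinite, then $\{\nu(Q_i):\deg Q_i=n\}$ is cofinal in $\{\nu(f): f\in K[x]\text{ monic},\deg f=n\}$. Truncations. Each $f\in K[x]$ has a unique $Q_i$-expansion $f=\sum_jd_{j,i}Q_i^j$ with $\deg d_{j,i}<\deg Q_i$; put $\nu_i(f)=\min_j\{\nu(d_{j,i})+j\beta_i\}$.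 A set of key polynomials is complete if for every nonzero $f\in K[x]$ there is $i\in\Lambda$ with $\nu_i(f)=\nu(f)$. *)

(* Defs.v *)
From HB Require Import structures.
From mathcomp Require Import all_boot all_order all_algebra.
From mathcomp Require Import finmap generic_quotient ring_quotient.
From mathcomp Require Import boolp classical_sets cardinality constructive_ereal.

Set Implicit Arguments.
Unset Strict Implicit.
Unset Printing Implicit Defensive.

Import Order.TTheory GRing.Theory.
Local Open Scope classical_set_scope.
Local Open Scope quotient_scope.
Local Open Scope ring_scope.

(* Totally ordered vector spaces over the rationals: the possible Gamma (x) Q
   for an ordered abelian group Gamma.  Compatibility of the order with
   multiplication by positive rationals follows from the axioms. *)
HB.mixin Record isOrderedQSpace V of GRing.Lmodule rat V := {
  qle : rel V;
  qle_anti : antisymmetric qle;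
  qle_trans : transitive qle;
  qle_total : total qle;
  qleD2l : forall z x y : V, qle x y -> qle (z + x) (z + y)
}.

#[short(type="ordQspaceType")]
HB.structure Definition OrderedQSpace :=
  {V of GRing.Lmodule rat V & isOrderedQSpace V}.

Definition qlt (V : ordQspaceType) (x y : V) : bool := ~~ qle y x.

(* The order on \bar V (the library has one only when V is a numDomainType). *)
Section ExtendedValues.
Variable V : ordQspaceType.
Implicit Types x y : \bar V.

Definition vle x y : bool :=
  match x, y with
  | -oo%E, _ => true
  | _, +oo%E => true
  | r%:E, s%:E => qle r s
  | _, _ => false
  end.

Definition vlt x y : bool := ~~ vle y x.

Definition vmin x y : \bar V := if vle x y then x else y.

Lemma qle_refl (v : V) : qle v v.
Proof. by have := qle_total v v; rewrite orbb. Qed.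

Lemma vle_refl x : vle x x.
Proof. by case: x => [r||] //=; exact: qle_refl. Qed.

Lemma vle_trans : transitive vle.
Proof. by case=> [r||] [s||] [t||] //=; apply: qle_trans. Qed.

Lemma vle_total : total vle.
Proof. by case=> [r||] [s||] //=; apply: qle_total. Qed.

Lemma vle_anti : antisymmetric vle.
Proof. by case=> [r||] [s||] //=; move/qle_anti->. Qed.

Lemma vltW x y : vlt x y -> vle x y.
Proof. by rewrite /vlt; case/orP: (vle_total x y) => -> //. Qed.

Lemma vlt_le_trans x y z : vlt x y -> vle y z -> vlt x z.
Proof. by move=> h1 h2; apply: contra h1; apply: vle_trans. Qed.

Lemma vle_lt_trans x y z : vle x y -> vlt y z -> vlt x z.
Proof. by move=> h1; apply: contra => h2; apply: vle_trans h2 h1. Qed.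

Lemma qleD (a b c e : V) : qle a b -> qle c e -> qle (a + c) (b + e).
Proof.
move=> h1 h2; apply: (@qle_trans _ (a + e)); first exact: qleD2l.
by rewrite ![_ + e]addrC; apply: qleD2l.
Qed.

Lemma qltD (a b c e : V) : qle a b -> qlt c e -> qlt (a + c) (b + e).
Proof.
move=> h1; apply: contra => h2.
have : qle (b + e) (b + c).
  by apply: qle_trans h2 _; rewrite ![_ + c]addrC; apply: qleD2l.
by move/(@qleD2l _ (- b)); rewrite !addrA addNr !add0r.
Qed.

Lemma double_eq0 (a : V) : a + a = 0 -> a = 0.
Proof.
move=> h; have : (2%:R : rat) *: a = 0 by rewrite scaler_nat mulr2n.
by move/eqP; rewrite scaler_eq0 => /orP[//|/eqP].
Qed.

End ExtendedValues.

Record valuation (F : fieldType) (V : ordQspaceType) := Valuation {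
  val_fun :> F -> \bar V;
  val_eqy : forall x, val_fun x = +oo%E <-> x = 0;
  val_neqNy : forall x, val_fun x <> -oo%E;
  valM : forall x y, val_fun (x * y) = (val_fun x + val_fun y)%E;
  valD : forall x y, vle (vmin (val_fun x) (val_fun y)) (val_fun (x + y))
}.

Section ValuationTheory.
Variables (F : fieldType) (V : ordQspaceType) (nu : valuation F V).
Implicit Types x y : F.

Lemma val0 : nu 0 = +oo%E.
Proof. exact/val_eqy. Qed.

Lemma valE x : x != 0 -> nu x = (fine (nu x))%:E.
Proof.
by case E: (nu x) => [r||] //; [move/val_eqy: E => ->; rewrite eqxx
  | have := @val_neqNy _ _ nu x].
Qed.

Lemma val1 : nu 1 = 0%:E.
Proof.
have := @valM _ _ nu 1 1; rewrite mulr1 (valE (oner_neq0 F)).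
by move=> [] /(congr1 (fun z => z - fine (nu 1))); rewrite subrr addrK => <-.
Qed.

Lemma valN1 : nu (-1) = 0%:E.
Proof.
have n1 : (-1 : F) != 0 by rewrite oppr_eq0 oner_neq0.
have := @valM _ _ nu (-1) (-1); rewrite mulrNN mulr1 val1 (valE n1).
by move=> [] /esym/double_eq0 ->.
Qed.

Lemma valN x : nu (- x) = nu x.
Proof. by rewrite -mulN1r valM valN1; exact: add0r. Qed.

Lemma val_leD b x y : vle b (nu x) -> vle b (nu y) -> vle b (nu (x + y)).
Proof.
move=> h1 h2; apply: vle_trans (valD nu x y).
by rewrite /vmin; case: ifP.
Qed.

Lemma val_ltD b x y : vlt b (nu x) -> vlt b (nu y) -> vlt b (nu (x + y)).
Proof.
move=> h1 h2; apply: vlt_le_trans (valD nu x y).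
by rewrite /vmin; case: ifP.
Qed.

Lemma val_leM (a b : V) x y :
  vle a%:E (nu x) -> vle b%:E (nu y) -> vle (a + b)%:E (nu (x * y)).
Proof.
rewrite valM; case: (nu x) (@val_neqNy _ _ nu x) => [r||] // _;
  case: (nu y) (@val_neqNy _ _ nu y) => [s||] // _.
exact: qleD.
Qed.

Lemma val_ltM (a b : V) x y :
  vle a%:E (nu x) -> vlt b%:E (nu y) -> vlt (a + b)%:E (nu (x * y)).
Proof.
rewrite valM; case: (nu x) (@val_neqNy _ _ nu x) => [r||] // _;
  case: (nu y) (@val_neqNy _ _ nu y) => [s||] // _.
exact: qltD.
Qed.

End ValuationTheory.

Section ResidueField.
Variables (F : fieldType) (V : ordQspaceType) (nu : valuation F V).

Definition vring_pred : pred F := fun x => vle 0%:E (nu x).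

Lemma vring_subring : subring_closed vring_pred.
Proof.
split; rewrite ?unfold_in /vring_pred ?val1 ?vle_refl // => x y;
  rewrite !unfold_in => hx hy.
- by apply: val_leD; rewrite ?valN.
- by rewrite -[0](addr0 0); apply: val_leM.
Qed.

HB.instance Definition _ := GRing.isSubringClosed.Build F vring_pred
  vring_subring.

Record valuation_ring := ValuationRing {
  vring_val : F; vring_valP : vring_val \in vring_pred }.

HB.instance Definition _ := [isSub for vring_val].
HB.instance Definition _ := [Choice of valuation_ring by <:].
HB.instance Definition _ := [SubChoice_isSubComNzRing of valuation_ring by <:].

Definition max_ideal : pred valuation_ring :=
  fun x => vlt 0%:E (nu (vring_val x)).

Lemma max_ideal_closed : idealr_closed max_ideal.
Proof.
split; rewrite ?unfold_in /max_ideal.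
- by rewrite (_ : vring_val 0 = 0) ?val0 //; exact: (rmorph0 (val : valuation_ring -> F)).
- rewrite (_ : vring_val 1 = 1); last exact: (rmorph1 (val : valuation_ring -> F)).
  by rewrite val1 /vlt vle_refl.
move=> a x y; rewrite !unfold_in => hx hy.
have -> : vring_val (a * x + y) = vring_val a * vring_val x + vring_val y.
  by rewrite -[vring_val]/(val : valuation_ring -> F) rmorphD rmorphM.
apply: val_ltD => //; rewrite -[0](addr0 0); apply: val_ltM => //.
exact: vring_valP.
Qed.

HB.instance Definition _ := isIdealr.Build valuation_ring max_ideal
  max_ideal_closed.

Definition residue_field : comNzRingType :=
  {ideal_quot (max_ideal : idealr valuation_ring)}.

End ResidueField.

(* char R if it is positive, 1 otherwise *)
Definition char_exponent (R : nzRingType) (p : nat) : Prop :=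
  p \in [pchar R] \/ [pchar R] =i pred0 /\ p = 1%N.

(* The direct sum of the P_b / P_b+ (b in V): an element is represented by a
   finite list of pairs (b, y) with y in P_b, standing for the sum of the
   classes of y in degree b; degrees outside the value group contribute 0. *)
Section AssociatedGraded.
Variables (F : fieldType) (V : ordQspaceType) (nu : valuation F V).

Definition gr_piece := {p : V * F | vle p.1%:E (nu p.2)}.
Definition gr_rep := seq gr_piece.
HB.instance Definition _ := Choice.on gr_rep.

Implicit Types (p q : gr_piece) (s t u : gr_rep) (b : V).

Definition gr_coef s b : F := \sum_(p <- s | (val p).1 == b) (val p).2.

Definition gr_equiv s t : bool :=
  `[< forall b, vlt b%:E (nu (gr_coef s b - gr_coef t b)) >].

Lemma gr_coef_eq s t : gr_coef s =1 gr_coef t -> gr_equiv s t.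
Proof. by move=> h; apply/asboolP => b; rewrite h subrr val0. Qed.

Lemma gr_equiv_class : equiv_class_of gr_equiv.
Proof.
split=> [s|s t|t s u].
- exact: gr_coef_eq.
- by apply/asboolP/asboolP => h b; rewrite -opprB valN.
- move=> /asboolP h1 /asboolP h2; apply/asboolP => b.
  by rewrite -(subrKA (gr_coef t b)); apply: val_ltD.
Qed.

Canonical gr_equivRel := EquivRelPack gr_equiv_class.
Canonical gr_encModRel := defaultEncModRel gr_equiv.

Definition gr := {eq_quot gr_equiv}.
HB.instance Definition _ : EqQuotient gr_rep gr_equiv gr := EqQuotient.on gr.
HB.instance Definition _ := Choice.on gr.

Lemma piece_oppP p : vle (val p).1%:E (nu (- (val p).2)).
Proof. by rewrite valN; exact: (valP p). Qed.
Definition piece_opp p : gr_piece :=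
  exist _ ((val p).1, - (val p).2) (piece_oppP p).

Lemma piece_mulP p q :
  vle ((val p).1 + (val q).1)%:E (nu ((val p).2 * (val q).2)).
Proof. by apply: val_leM; [exact: (valP p)|exact: (valP q)]. Qed.
Definition piece_mul p q : gr_piece :=
  exist _ ((val p).1 + (val q).1, (val p).2 * (val q).2) (piece_mulP p q).

Lemma piece_oneP : vle (0 : V)%:E (nu 1).
Proof. by rewrite val1 vle_refl. Qed.
Definition piece_one : gr_piece := exist _ (0, 1) piece_oneP.

Definition rep_add s t : gr_rep := s ++ t.
Definition rep_opp s : gr_rep := map piece_opp s.
Definition rep_mul s t : gr_rep := [seq piece_mul p q | p <- s, q <- t].
Definition rep_one : gr_rep := [:: piece_one].

Lemma coef_nil b : gr_coef [::] b = 0.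
Proof. by rewrite /gr_coef big_nil. Qed.

Lemma coef_add s t b : gr_coef (rep_add s t) b = gr_coef s b + gr_coef t b.
Proof. by rewrite /gr_coef big_cat. Qed.

Lemma coef_opp s b : gr_coef (rep_opp s) b = - gr_coef s b.
Proof. by rewrite /gr_coef big_map /= sumrN. Qed.

Lemma coef_mul s t b :
  gr_coef (rep_mul s t) b =
  \sum_(p <- s) (val p).2 * gr_coef t (b - (val p).1).
Proof.
rewrite /gr_coef /rep_mul big_mkcond big_allpairs_dep /=; apply: eq_bigr => p _.
rewrite mulr_sumr [RHS]big_mkcond /=; apply: eq_bigr => q _.
by rewrite [(sval q).1 == _]eq_sym subr_eq eq_sym addrC.
Qed.

Lemma coef_mulC s t : gr_coef (rep_mul s t) =1 gr_coef (rep_mul t s).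
Proof.
move=> b; rewrite /gr_coef /rep_mul !(big_mkcond (fun p => (sval p).1 == b)).
rewrite !big_allpairs_dep exchange_big /=.
by apply: eq_bigr => q _; apply: eq_bigr => p _; rewrite addrC mulrC.
Qed.

Lemma coef_mulA s t u :
  gr_coef (rep_mul s (rep_mul t u)) =1 gr_coef (rep_mul (rep_mul s t) u).
Proof.
move=> b; rewrite !coef_mul /rep_mul big_allpairs_dep /=.
apply: eq_bigr => p _; rewrite coef_mul mulr_sumr.
by apply: eq_bigr => q _; rewrite mulrA opprD addrA.
Qed.

Lemma equiv_mulr s t t' :
  gr_equiv t t' -> gr_equiv (rep_mul s t) (rep_mul s t').
Proof.
move=> /asboolP h; apply/asboolP => b; rewrite !coef_mul -sumrB.
elim: s => [|p s IHs]; first by rewrite big_nil val0.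
rewrite big_cons; apply: val_ltD => //; rewrite -mulrBr.
rewrite -{1}(subrK (val p).1 b) addrC; apply: val_ltM; first exact: (valP p).
exact: h.
Qed.

Lemma equiv_mul s s' t t' : gr_equiv s s' -> gr_equiv t t' ->
  gr_equiv (rep_mul s t) (rep_mul s' t').
Proof.
move=> h1 h2; apply: (equiv_trans (equiv_mulr s h2)).
apply: (equiv_trans (gr_coef_eq (coef_mulC s t'))).
by apply: (equiv_trans (equiv_mulr t' h1)); apply/gr_coef_eq/coef_mulC.
Qed.

Definition gr_zero : gr := lift_cst gr [::].
Definition gr_one : gr := lift_cst gr rep_one.
Definition gr_opp := lift_op1 gr rep_opp.
Definition gr_add := lift_op2 gr rep_add.
Definition gr_mul := lift_op2 gr rep_mul.

Lemma repr_equiv s : gr_equiv s (repr (\pi_gr s)).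
Proof. by apply/eqmodP; rewrite reprK. Qed.

Canonical pi_gr_zero_morph := PiConst gr_zero.
Canonical pi_gr_one_morph := PiConst gr_one.

Lemma pi_gr_opp : {morph \pi : s / rep_opp s >-> gr_opp s}.
Proof.
move=> s; unlock gr_opp; apply/eqmodP/asboolP => b; rewrite !coef_opp -opprD.
by rewrite valN; have /asboolP := repr_equiv s; apply.
Qed.
Canonical pi_gr_opp_morph := PiMorph1 pi_gr_opp.

Lemma pi_gr_add : {morph \pi : s t / rep_add s t >-> gr_add s t}.
Proof.
move=> s t; unlock gr_add; apply/eqmodP/asboolP => b.
rewrite !coef_add opprD addrACA.
have /asboolP h1 := repr_equiv s; have /asboolP h2 := repr_equiv t.
exact: val_ltD.
Qed.
Canonical pi_gr_add_morph := PiMorph2 pi_gr_add.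

Lemma pi_gr_mul : {morph \pi : s t / rep_mul s t >-> gr_mul s t}.
Proof.
by move=> s t; unlock gr_mul; apply/eqmodP/equiv_mul; exact: repr_equiv.
Qed.
Canonical pi_gr_mul_morph := PiMorph2 pi_gr_mul.

Lemma pi_coef_eq s t : gr_coef s =1 gr_coef t -> \pi_gr s = \pi_gr t.
Proof. by move=> h; apply/eqmodP/gr_coef_eq. Qed.

Lemma gr_addA : associative gr_add.
Proof.
move=> x y z; rewrite -[x]reprK -[y]reprK -[z]reprK !piE.
by apply/pi_coef_eq => b; rewrite !coef_add addrA.
Qed.

Lemma gr_addC : commutative gr_add.
Proof.
move=> x y; rewrite -[x]reprK -[y]reprK !piE.
by apply/pi_coef_eq => b; rewrite !coef_add addrC.
Qed.

Lemma gr_add0 : left_id gr_zero gr_add.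
Proof.
move=> x; rewrite -[x]reprK !piE.
by apply/pi_coef_eq => b; rewrite coef_add coef_nil add0r.
Qed.

Lemma gr_addN : left_inverse gr_zero gr_opp gr_add.
Proof.
move=> x; rewrite -[x]reprK !piE.
by apply/pi_coef_eq => b; rewrite coef_add coef_opp coef_nil addNr.
Qed.

HB.instance Definition _ :=
  GRing.isZmodule.Build gr gr_addA gr_addC gr_add0 gr_addN.

Lemma gr_mulA : associative gr_mul.
Proof.
move=> x y z; rewrite -[x]reprK -[y]reprK -[z]reprK !piE.
exact/pi_coef_eq/coef_mulA.
Qed.

Lemma gr_mulC : commutative gr_mul.
Proof.
move=> x y; rewrite -[x]reprK -[y]reprK !piE.
exact/pi_coef_eq/coef_mulC.
Qed.

Lemma gr_mul1 : left_id gr_one gr_mul.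
Proof.
move=> x; rewrite -[x]reprK !piE; apply/pi_coef_eq => b.
by rewrite coef_mul big_seq1 /= mul1r subr0.
Qed.

Lemma gr_mulD : left_distributive gr_mul +%R.
Proof.
move=> x y z; rewrite -[x]reprK -[y]reprK -[z]reprK.
rewrite -[(_ + _)%R]/(gr_add _ _) -[(gr_mul _ _ + _)%R]/(gr_add _ _) !piE.
by apply/pi_coef_eq => b; rewrite coef_add !coef_mul big_cat.
Qed.

Lemma gr_one_neq0 : gr_one != 0.
Proof.
rewrite -[0]/gr_zero; apply/negP => /eqP; rewrite !piE => /eqmodP/asboolP/(_ 0).
by rewrite /gr_coef big_nil big_mkcond big_seq1 eqxx subr0 val1 /vlt vle_refl.
Qed.

HB.instance Definition _ := GRing.Zmodule_isComNzRing.Build gr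
  gr_mulA gr_mulC gr_mul1 gr_mulD gr_one_neq0.

(* the class of y in degree b, when y is in P_b (0 otherwise) *)
Definition gr_class (b : V) (y : F) : gr :=
  if insub (b, y) is Some p then \pi_gr [:: (p : gr_piece)] else 0.

Definition gr_in (y : F) : gr := gr_class (fine (nu y)) y.

Definition gr_homogeneous (g : gr) : Prop := exists b y, g = gr_class b y.

Definition gr_subring (A : set gr) : Prop :=
  [/\ A 1, forall g h, A g -> A h -> A (g - h)
    & forall g h, A g -> A h -> A (g * h)].

(* All homogeneous g != 0 are units of gr, so A^* sits inside gr, g / h being
   the unique z with z * h = g. *)
Definition gr_star (A : set gr) : set gr :=
  [set z | exists g h,
     [/\ A g, A h, h != 0, gr_homogeneous h & z * h = g]].

End AssociatedGraded.

(* The equation P(z) = 0 is the minimal algebraic relation of z over A. *)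
Definition minimal_relation (R : comNzRingType) (A : set R) (z : R)
    (P : {poly R}) : Prop :=
  [/\ P \is monic, forall j, A P`_j, root P z
    & forall P' : {poly R}, P' != 0 -> (forall j, A P'`_j) -> root P' z ->
        (size P <= size P')%N].

Section WellOrderedIndices.
Context {d : Order.disp_t} {Lam : bOrderType d}.
Variable alpha : Lam -> nat.
Implicit Types (i j k : Lam) (D : set Lam).
Local Open Scope order_scope.

Definition is_succ i j : Prop := i < j /\ forall k, i < k -> j <= k.

(* j = i + t *)
Fixpoint is_shift i (t : nat) j : Prop :=
  if t is t'.+1 then exists2 k, is_shift i t' k & is_succ k j else j = i.

(* j is an upper bound of the i + t, all of which exist *)
Definition above_shifts i j : Prop :=
  forall t : nat, exists2 k, is_shift i t k & k < j.

(* j = i + omega *)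
Definition is_shift_omega i j : Prop :=
  above_shifts i j /\ forall k, above_shifts i k -> j <= k.

(* The next two notions are relative to an initial segment D of Lam. *)
Definition inessential D i : Prop :=
  (exists2 j, D j & is_shift_omega i j) /\
  forall (t : nat) k, is_shift i t k -> alpha k = 1%N.

(* j = i+ *)
Definition is_plus D i j : Prop :=
  D j /\ (inessential D i /\ is_shift_omega i j
          \/ ~ inessential D i /\ is_succ i j).

Definition maximal_index i : Prop := forall j, j <= i.

(* exponents of the l-standard monomials *)
Definition standard_exponent (l : Lam) (g : {fsfun Lam -> nat with 0%N}) :
    Prop :=
  let D := [set q | q <= l] in
  [/\ forall i, g i <> 0%N -> i <= l,
      forall i j, i < l -> is_plus D i j -> (g i < alpha j)%N
    & forall i k j j', inessential D i -> is_plus D i k ->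
        is_plus D j k -> is_plus D j' k -> g j <> 0%N -> g j' <> 0%N ->
        j = j'].

Definition free_exponent (l : Lam) (g : {fsfun Lam -> nat with 0%N}) : Prop :=
  standard_exponent l g /\ g l = 0%N.

End WellOrderedIndices.

Section KeyPolynomials.
Variables (K : fieldType) (V : ordQspaceType).
Variable nu : valuation {fraction {poly K}} V.

Definition pfrac (f : {poly K}) : {fraction {poly K}} := tofrac f.
Definition pval (f : {poly K}) : \bar V := nu (pfrac f).

(* V is Gamma (x) Q, where Gamma is the value group *)
Definition rational_hull : Prop :=
  forall v : V, exists (n : nat) (y : {fraction {poly K}}),
    (0 < n)%N /\ nu y = (v *+ n)%:E.

Definition Gamma0 : set V := [set v | exists c : K, pval c%:P = v%:E].

Definition Gamma0Q : set V :=
  [set v | exists2 n : nat, (0 < n)%N & Gamma0 (v *+ n)].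

Definition convex_subgroup (H : set V) : Prop :=
  [/\ H `<=` Gamma0, H 0, forall u v, H u -> H v -> H (u - v)
    & forall u v, H v -> Gamma0 u -> qle 0 u -> qle u v -> H u].

Definition rank_nuK_eq1 : Prop :=
  Gamma0 <> [set 0] /\
  forall H, convex_subgroup H -> H = [set 0] \/ H = Gamma0.

Section Family.
Context {d : Order.disp_t} {Lam : bOrderType d}.
Variables (alpha : Lam -> nat) (Q : Lam -> {poly K}).
Implicit Types (i l : Lam) (f : {poly K}).

Definition beta i : V := fine (pval (Q i)).

Definition expo_prod (g : {fsfun Lam -> nat with 0%N}) : {poly K} :=
  \prod_(i <- finsupp g) Q i ^+ g i.

Definition monomial (m : K * {fsfun Lam -> nat with 0%N}) : {poly K} :=
  m.1 *: expo_prod m.2.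

Definition free_std_expansion l
    (s : seq (K * {fsfun Lam -> nat with 0%N})) : Prop :=
  (forall m, m \in s -> free_exponent alpha l m.2) /\
  pval (\sum_(m <- s) monomial m) =
    \big[@vmin V/+oo%E]_(m <- s) pval (monomial m).

Definition free_std_poly l f : Prop :=
  exists2 s, free_std_expansion l s & f = \sum_(m <- s) monomial m.

(* The expansion f = sum_j c_j Q_l^j is given as the polynomial c with
   coefficients c_j. *)
Definition std_expansion l f (c : {poly {poly K}}) : Prop :=
  (forall j, free_std_poly l c`_j) /\ f = c.[Q l].

Definition expansion_min l (c : {poly {poly K}}) : \bar V :=
  \big[@vmin V/+oo%E]_(j < size c) pval (c`_j * Q l ^+ j).

(* G_{nu_K}[in_nu Q_q, q < i]^*, where G_{nu_K} is identified with its image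
   in gr nu, the subring generated by the in_nu c, c in K. *)
Definition gr_field_below i : set (gr nu) :=
  gr_star (smallest (@gr_subring _ _ nu)
    ([set gr_in nu (pfrac c%:P) | c in [set: K]] `|`
     [set gr_in nu (pfrac (Q q)) | q in [set q | (q < i)%O]])).

Definition successor_condition : Prop :=
  forall i' i, is_succ i' i ->
  exists s : nat -> seq (K * {fsfun Lam -> nat with 0%N}),
  [/\ Q i = Q i' ^+ alpha i
            + \sum_(j < alpha i) (\sum_(m <- s j) monomial m) * Q i' ^+ j,
      forall j, (j < alpha i)%N -> free_std_expansion i' (s j),
      forall j m, (j < alpha i)%N -> m \in s j ->
        pval (monomial m * Q i' ^+ j) = pval (Q i' ^+ alpha i)
    & minimal_relation (gr_field_below i') (gr_in nu (pfrac (Q i')))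
        ('X^(alpha i) +
         \sum_(j < alpha i)
           (\sum_(m <- s j) gr_in nu (pfrac m.1%:P)
                            * gr_in nu (pfrac (expo_prod m.2))) *: 'X^j)].

Definition increases_truncations i f : Prop :=
  forall i0, is_plus alpha [set: Lam] i0 i ->
    (exists c, std_expansion i0 f c) /\
    (forall c, std_expansion i0 f c -> vlt (expansion_min i0 c) (pval f)).

Definition limit_condition : Prop :=
  forall i, i <> \bot%O -> ~ (exists i', is_succ i' i) ->
  [/\ exists i0, is_plus alpha [set: Lam] i0 i,
      forall i0, is_plus alpha [set: Lam] i0 i ->
        (exists2 c, std_expansion i0 (Q i) c & (size c <= (alpha i).+1)%N),
      increases_truncations i (Q i),
      forall f, increases_truncations i f -> (size (Q i) <= size f)%N
    & (~ maximal_index i \/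
       (exists2 v, Gamma0Q v & forall i', (i' < i)%O -> qle (beta i') v)) ->
      forall i0 c, is_plus alpha [set: Lam] i0 i -> std_expansion i0 (Q i) c ->
        [/\ c`_(alpha i) = 1,
            expansion_min i0 c = (beta i0 *+ alpha i)%:E
          & pval c`_0 = (beta i0 *+ alpha i)%:E]].

Definition cofinality_condition : Prop :=
  forall n : nat, ~ finite_set [set i | size (Q i) = n.+1] ->
  forall f, f \is monic -> size f = n.+1 ->
  exists2 i, size (Q i) = n.+1 & vle (pval f) (pval (Q i)).

Definition pre_key_polynomials : Prop :=
  [/\ forall i, (0 < alpha i)%N, alpha \bot%O = 1%N,
      forall i, Q i \is monic, Q \bot%O = 'X
    & forall i i0, i <> \bot%O -> ~ maximal_index i ->
        (i0 < i)%O -> is_plus alpha [set: Lam] i0 i ->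
        (size (Q i)).-1 = (alpha i * (size (Q i0)).-1)%N].

Definition key_polynomials : Prop :=
  [/\ pre_key_polynomials,
      forall i, ~ maximal_index i -> Gamma0Q (beta i),
      successor_condition, limit_condition & cofinality_condition].

Definition Q_expansion i f (c : {poly {poly K}}) : Prop :=
  (forall j, (size (c`_j)%R < size (Q i))%N) /\ f = c.[Q i].

(* v = nu_i(f) *)
Definition is_truncation i f (v : \bar V) : Prop :=
  exists2 c, Q_expansion i f c &
    v = \big[@vmin V/+oo%E]_(j < size c) (pval c`_j + (beta i *+ j)%:E)%E.

Definition complete_family : Prop :=
  forall f, f != 0 -> exists i, is_truncation i f (pval f).

End Family.

(* (nu(f) - nu(d_b f)) / b with d_b the b-th Hasse derivative; it is -oo when
   d_b f = 0 *)
Definition hasse_slope (f : {poly K}) (b : nat) : \bar V :=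
  er_map (fun v => (b%:R^-1 : rat) *: v) (adde (pval f) (oppe (pval f^`N(b)))).

Definition maximizes_slope (f : {poly K}) (b : nat) : Prop :=
  (0 < b)%N /\
  forall c, (0 < c)%N -> vle (hasse_slope f c) (hasse_slope f b).

Definition smallest_maximizer (f : {poly K}) (b : nat) : Prop :=
  maximizes_slope f b /\ forall c, maximizes_slope f c -> (b <= c)%N.

Lemma hasse_slope_large (f : {poly K}) b : (size f <= b)%N -> hasse_slope f b = -oo%E.
Proof.
move=> h; have f0 : f^`N(b) = 0.
  apply/polyP => j; rewrite coef_nderivn coef0 nth_default ?mul0rn //.
  exact: leq_trans h (leq_addr _ _).
rewrite /hasse_slope f0 /pval /pfrac tofrac0 val0 /=.
by case: (nu _) (@val_neqNy _ _ nu (tofrac f)) => [r||] // _.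
Qed.

Lemma smallest_maximizer_exists (f : {poly K}) : exists b, smallest_maximizer f b.
Proof.
have [m mP] : exists b, maximizes_slope f b.
  have [m m0 mP] : exists2 m, (0 < m)%N & forall c, (0 < c <= (size f).+1)%N ->
      vle (hasse_slope f c) (hasse_slope f m).
    elim: (size f) => [|n [m m0 mP]].
      by exists 1%N => // c; rewrite -eqn_leq eq_sym => /eqP->; exact: vle_refl.
    case/orP: (vle_total (hasse_slope f m) (hasse_slope f n.+2)) => h.
      exists n.+2 => // c /andP[c0]; rewrite leq_eqVlt => /orP[/eqP->|hc].
        exact: vle_refl.
      by apply: vle_trans h; apply: mP; rewrite c0.
    exists m => // c /andP[c0]; rewrite leq_eqVlt => /orP[/eqP->//|hc].
    by apply: mP; rewrite c0.
  exists m; split=> // c c0; case: (leqP c (size f).+1) => hc.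
    by apply: mP; rewrite c0.
  by rewrite hasse_slope_large //; apply: ltnW; apply: ltnW.
have ex : exists b, `[< maximizes_slope f b >] by exists m; apply/asboolP.
case: (ex_minnP ex) => b /asboolP bP bmin; exists b; split=> // c cP.
by apply: bmin; apply/asboolP.
Qed.

Definition I_max (f : {poly K}) (b : nat) : set nat :=
  [set c | (0 < c)%N /\ hasse_slope f c = hasse_slope f b].

End KeyPolynomials.

(* Main.v *)
Require Import Defs.
From mathcomp Require Import all_boot all_order all_algebra.
From mathcomp Require Import finmap generic_quotient ring_quotient zify.
From mathcomp Require Import boolp classical_sets cardinality constructive_ereal.

Set Implicit Arguments.
Unset Strict Implicit.
Unset Printing Implicit Defensive.

Import Order.TTheory GRing.Theory.
Local Open Scope classical_set_scope.
Local Open Scope ring_scope.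

(** Write [eps_i] for the largest slope of [Q_i].  The crux is that the key
    polynomials are key polynomials in the abstract sense: every nonzero [f]
    with [deg f < deg Q_i] has all its slopes below [eps_i].  Granted this, let
    [n] be a maximizer for [Q_i] and choose [p ^ e <= n] with ['C(n, p ^ e)] a
    unit of the residue field.  If [m := n - p ^ e] were positive, the crux
    applied to [Q_i^`N(m)], whose [p ^ e]-th derivative is
    ['C(n, p ^ e) * Q_i^`N(n)], would make the slope at [n] smaller than [eps_i].

    The crux is proved by induction on [i].  Refine [nu_i] to the lexicographic
    filtration by (value, exponent of [Q_i]) of the terms of [Q_i]-expansions;
    the crux at [i] makes it multiplicative.  If [f] has a term [d Q_i^j],
    [j > 0], of minimal value, with [j] minimal, then for the smallest maximizer
    [q] of [Q_i] the derivative of order [p^s q], where [p^s] is the [p]-part of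
    [j], has [nu_i] exactly [nu_i(f) - p^s q eps_i]: its lowest term comes from
    ['C(j, p^s) d (Q_i^`N(q))^(p^s) Q_i^(j - p^s)].  Hence [nu_i(f) < nu(f)]
    forces a slope of [f] above [eps_i] as soon as [nu_i] and [nu] agree on the
    derivatives of [f].  This applies to [f = Q_l], [l > i], because
    polynomials of degree less than [deg Q_l] have [nu_i = nu] for [i] close
    enough to [l]: by minimality of the algebraic relation if [l] is a successor,
    by minimality of the degree of [Q_l] if [l] is a limit. *)

(** * Values of polynomials *)

Section OrderedQSpaceLemmas.
Variable V : ordQspaceType.
Implicit Types u v w : V.

Lemma qltW u v : qlt u v -> qle u v.
Proof. by rewrite /qlt; case/orP: (qle_total u v) => -> //. Qed.

Lemma qle_lt_trans u v w : qle u v -> qlt v w -> qlt u w.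
Proof. by move=> h1; apply: contra => h2; apply: qle_trans h2 h1. Qed.

Lemma qle_eqVlt u v : qle u v -> u = v \/ qlt u v.
Proof.
move=> h; case: (boolP (qle v u)) => h'; last by right.
by left; apply: qle_anti; rewrite h.
Qed.

Lemma qleD2r w u v : qle (u + w) (v + w) = qle u v.
Proof.
apply/idP/idP => [/(qleD2l (- w))|h]; first by rewrite ![_ + w]addrC !addKr.
by rewrite ![_ + w]addrC; apply: qleD2l.
Qed.

Lemma qltD2r w u v : qlt (u + w) (v + w) = qlt u v.
Proof. by rewrite /qlt qleD2r. Qed.

Lemma qleN2 u v : qle (- u) (- v) = qle v u.
Proof.
by rewrite -(qleD2r (u + v)) addrA addNr add0r [u + v]addrC addrA addNr add0r.
Qed.

Lemma qleMn n u v : qle u v -> qle (u *+ n) (v *+ n).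
Proof.
move=> h; elim: n => [|n IHn]; first by rewrite !mulr0n qle_refl.
by rewrite !mulrS; apply: qleD.
Qed.

Lemma qltMn n u v : (0 < n)%N -> qlt u v -> qlt (u *+ n) (v *+ n).
Proof.
case: n => // n _ h; rewrite !mulrSr; apply: qltD => //.
exact/qleMn/qltW.
Qed.

Lemma qle_pMn n u v : (0 < n)%N -> qle (u *+ n) (v *+ n) = qle u v.
Proof.
move=> n0; apply/idP/idP => [|/qleMn//].
by apply: contraLR => h; apply: qltMn.
Qed.

Lemma invn_scaleMn n u : (0 < n)%N -> ((n%:R^-1 : rat) *: u) *+ n = u.
Proof.
move=> n0; rewrite -scaler_nat scalerA divff ?scale1r //.
by rewrite Num.Theory.pnatr_eq0 -lt0n.
Qed.

End OrderedQSpaceLemmas.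

Section PolynomialValues.
Variables (K : fieldType) (V : ordQspaceType).
Variable nu : valuation {fraction {poly K}} V.
Implicit Types (f g h : {poly K}) (v w : V).

(** Bounds by elements of [V] instead of values in [\bar V]: zero satisfies every [ge] and [gt], so
    sums need no case distinction on vanishing terms. *)
Definition pval_ge v f := vle v%:E (pval nu f).
Definition pval_gt v f := vlt v%:E (pval nu f).
Definition pval_eqv f v := pval nu f = v%:E.
Local Notation ge := pval_ge.
Local Notation gt := pval_gt.
Local Notation eqv := pval_eqv.

Lemma pval0 : pval nu 0 = +oo%E.
Proof. by rewrite /pval /pfrac tofrac0 val0. Qed.

Lemma pval1 : eqv 1 0.
Proof. by rewrite /pval_eqv /pval /pfrac tofrac1 Defs.val1. Qed.

Lemma pvalM f g : pval nu (f * g) = (pval nu f + pval nu g)%E.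
Proof. by rewrite /pval /pfrac tofracM Defs.valM. Qed.

Lemma pvalN f : pval nu (- f) = pval nu f.
Proof. by rewrite /pval /pfrac tofracN valN. Qed.

Lemma pval_fin f : f != 0 -> exists v, eqv f v.
Proof.
move=> f0; exists (fine (pval nu f)); rewrite /pval_eqv /pval; apply: valE.
by rewrite /pfrac tofrac_eq0.
Qed.

Lemma eqv_neq0 f v : eqv f v -> f != 0.
Proof. by move=> h; apply/eqP => f0; move: h; rewrite /pval_eqv f0 pval0. Qed.

Lemma eqv_inj f v w : eqv f v -> eqv f w -> v = w.
Proof. by rewrite /pval_eqv => -> []. Qed.

Lemma ge0 v : ge v 0. Proof. by rewrite /pval_ge pval0. Qed.
Lemma gt0 v : gt v 0. Proof. by rewrite /pval_gt pval0. Qed.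

Lemma gt_ge v f : gt v f -> ge v f. Proof. exact: vltW. Qed.

Lemma ge_le v w f : qle v w -> ge w f -> ge v f.
Proof. by move=> h; apply: (@vle_trans _ w%:E). Qed.

Lemma gt_le v w f : qle v w -> gt w f -> gt v f.
Proof. by move=> h; apply: (@vle_lt_trans _ _ w%:E). Qed.

Lemma gt_lt v w f : qlt v w -> ge w f -> gt v f.
Proof. by move=> h; apply: (@vlt_le_trans _ _ w%:E). Qed.

Lemma geN v f : ge v (- f) = ge v f. Proof. by rewrite /pval_ge pvalN. Qed.
Lemma gtN v f : gt v (- f) = gt v f. Proof. by rewrite /pval_gt pvalN. Qed.

Lemma geD v f g : ge v f -> ge v g -> ge v (f + g).
Proof. by rewrite /pval_ge /pval /pfrac tofracD; apply: val_leD. Qed.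

Lemma gtD v f g : gt v f -> gt v g -> gt v (f + g).
Proof. by rewrite /pval_gt /pval /pfrac tofracD; apply: val_ltD. Qed.

Lemma ge_sum (I : Type) (r : seq I) (P : pred I) (F : I -> {poly K}) v :
  (forall i, P i -> ge v (F i)) -> ge v (\sum_(i <- r | P i) F i).
Proof. by move=> h; apply: (big_ind (ge v)) => //; [exact: ge0 | move=> *; exact: geD]. Qed.

Lemma gt_sum (I : Type) (r : seq I) (P : pred I) (F : I -> {poly K}) v :
  (forall i, P i -> gt v (F i)) -> gt v (\sum_(i <- r | P i) F i).
Proof. by move=> h; apply: (big_ind (gt v)) => //; [exact: gt0 | move=> *; exact: gtD]. Qed.

Lemma geM v w f g : ge v f -> ge w g -> ge (v + w) (f * g).
Proof. by rewrite /pval_ge /pval /pfrac tofracM; apply: val_leM. Qed.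

Lemma gtMr v w f g : ge v f -> gt w g -> gt (v + w) (f * g).
Proof. by rewrite /pval_gt /pval_ge /pval /pfrac tofracM; apply: val_ltM. Qed.

Lemma gtMl v w f g : gt v f -> ge w g -> gt (v + w) (f * g).
Proof. by move=> hf hg; rewrite addrC mulrC; apply: gtMr. Qed.

Lemma eqvM f g v w : eqv f v -> eqv g w -> eqv (f * g) (v + w).
Proof. by rewrite /pval_eqv pvalM => -> ->. Qed.

Lemma eqvX f v n : eqv f v -> eqv (f ^+ n) (v *+ n).
Proof.
move=> h; elim: n => [|n IHn]; first by rewrite mulr0n expr0; apply: pval1.
by rewrite exprS mulrS; apply: eqvM.
Qed.

Lemma eqv_ge f v : eqv f v -> ge v f.
Proof. by rewrite /pval_ge => ->; apply: vle_refl. Qed.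

Lemma eqv_geE f v w : eqv f v -> ge w f = qle w v.
Proof. by rewrite /pval_ge => ->. Qed.

Lemma eqv_gtE f v w : eqv f v -> gt w f = qlt w v.
Proof. by rewrite /pval_gt => ->. Qed.

Lemma eqv_ngt f v : eqv f v -> ~~ gt v f.
Proof. by move=> h; rewrite (eqv_gtE _ h) /qlt qle_refl. Qed.

Lemma ge_eqVgt f v : ge v f -> eqv f v \/ gt v f.
Proof.
case: (eqVneq f 0) => [-> _|/pval_fin[w hw]]; first by right; exact: gt0.
rewrite (eqv_geE _ hw) (eqv_gtE _ hw) => /qle_eqVlt[->|]; first by left.
by right.
Qed.

Lemma eqvDr f g v : eqv f v -> gt v g -> eqv (f + g) v.
Proof.
move=> hf hg; have := geD (eqv_ge hf) (gt_ge hg).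
case/ge_eqVgt => // h; case/negP: (eqv_ngt hf).
by rewrite -(addrK g f); apply: gtD => //; rewrite gtN.
Qed.

End PolynomialValues.

(** * Hasse derivatives and binomials *)

Lemma nderivnMX (R : nzRingType) (h : {poly R}) n :
  (h * 'X)^`N(n) = h^`N(n) * 'X + (if n is n'.+1 then h^`N(n') else 0).
Proof.
case: n => [|n] /=; first by rewrite !nderivn0 addr0.
by have := nderivnMXaddC n h 0; rewrite polyC0 addr0 => ->; rewrite addrC.
Qed.

Lemma nderivnM (R : comNzRingType) (f g : {poly R}) n :
  (f * g)^`N(n) = \sum_(k < n.+1) f^`N(k) * g^`N(n - k).
Proof.
elim/poly_ind: f n => [|f c IHf] n.
  by rewrite mul0r linear0 big1 // => k _; rewrite linear0 mul0r.
have -> : (f * 'X + c%:P) * g = (f * g) * 'X + c *: g.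
  by rewrite mulrDl mul_polyC mulrAC.
rewrite linearD linearZ /= nderivnMX IHf.
have -> : \sum_(k < n.+1) (f * 'X + c%:P)^`N(k) * g^`N(n - k) =
    \sum_(k < n.+1) (f^`N(k) * g^`N(n - k)) * 'X
    + \sum_(k < n.+1) (if nat_of_ord k is k'.+1 then f^`N(k') else 0) * g^`N(n - k)
    + \sum_(k < n.+1) (c%:P)^`N(k) * g^`N(n - k).
  rewrite -!big_split; apply: eq_bigr => k _ /=.
  by rewrite linearD /= nderivnMX !mulrDl mulrAC.
congr (_ + _ + _); first by rewrite mulr_suml.
- by case: n => [|n]; rewrite big_ord_recl mul0r add0r ?big_ord0 // IHf.
- rewrite big_ord_recl big1 => [|k _]; last by rewrite nderivnC mul0r.
  by rewrite nderivnC subn0 addr0 mul_polyC.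
Qed.

Lemma nderivn_comp (R : nzRingType) (f : {poly R}) m n :
  f^`N(m)^`N(n) = f^`N(m + n) *+ 'C(m + n, n).
Proof.
apply/polyP => i; rewrite coefMn !coef_nderivn addnA -!mulrnA; congr (_ *+ _).
(* Both coefficients are the trinomial coefficient of [m], [n] and [i], as is seen after
   multiplication by the three factorials. *)
have h : forall a b c, ('C(a + b + c, a) * 'C(b + c, b) * (a`! * b`! * c`!)
    = (a + b + c)`!)%N.
  move=> a b c; have e1 := @bin_fact (a + b + c) a; have e2 := @bin_fact (b + c) b.
  rewrite -addnA addKn leq_addr in e1; rewrite addKn leq_addr in e2.
  rewrite -addnA -e1 // -e2 // !mulnA; congr muln; rewrite -!mulnA.
  by congr muln; rewrite mulnCA.
apply/eqP; rewrite -(@eqn_pmul2r (m`! * n`! * i`!)) ?muln_gt0 ?fact_gt0 //.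
apply/eqP; rewrite h (addnC m n).
have -> : (n + m + i = m + n + i)%N by rewrite (addnC m).
have := h (m + n)%N i 0; rewrite !addn0 fact0 binn !muln1 => <-.
rewrite -(@bin_fact (m + n)%N n) ?leq_addl // addnK !mulnA (addnC n m).
by congr (_ * _)%N; rewrite mulnAC.
Qed.

Lemma size_nderivn_lt (R : nzRingType) (f : {poly R}) n :
  (0 < n)%N -> f != 0 -> (size f^`N(n) < size f)%N.
Proof.
move=> n0 f0; rewrite /nderivn (leq_ltn_trans (size_poly _ _)) // ltn_subrL n0.
by rewrite size_poly_gt0.
Qed.

(** Over ['F_p], the coefficients of degree [p ^ s] in [(1 + X)^(p^s u) = (1 + X^(p^s))^u] show that
    the binomial is congruent to [u]. *)
Lemma prime_ndvd_bin_expn p s u : prime p -> ~~ (p %| u)%N ->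
  ~~ (p %| 'C(p ^ s * u, p ^ s))%N.
Proof.
move=> pp pu; have pF : p \in [pchar 'F_p] by exact: pchar_Fp.
have key : ('C(p ^ s * u, p ^ s)%:R : 'F_p) = u%:R.
  have ps0 : (0 < p ^ s)%N by rewrite expn_gt0 prime_gt0.
  have cbin n m : ((1 + 'X : {poly 'F_p}) ^+ n)`_m = 'C(n, m)%:R.
    rewrite exprDn coef_sum; case: (ltnP m n.+1) => hm.
      rewrite (bigD1 (Ordinal hm)) //= expr1n mul1r coefMn coefXn eqxx big1 ?addr0 //.
      move=> i /eqP hi; rewrite expr1n mul1r coefMn coefXn.
      by case: eqP => // E; [case: hi; apply: val_inj | rewrite mul0rn].
    rewrite bin_small // big1 // => i _; rewrite expr1n mul1r coefMn coefXn.
    by rewrite gtn_eqF ?mul0rn // (leq_trans (ltn_ord i)).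
  rewrite -cbin exprM.
  have -> : (1 + 'X : {poly 'F_p}) ^+ (p ^ s) = 1 + 'X^(p ^ s).
    have pP : p \in [pchar {poly 'F_p}] by rewrite pchar_poly.
    elim: s {ps0} => [|s IHs]; first by rewrite !expr1.
    rewrite expnSr exprM IHs -!(pFrobenius_autE pP) pFrobenius_autD_comm.
      by rewrite pFrobenius_aut1 pFrobenius_autE -exprM.
    exact: mulrC.
  rewrite exprDn coef_sum; case: u pu => [|u] pu; first by rewrite dvdn0 in pu.
  rewrite (bigD1 (Ordinal (erefl : 1 < u.+2)%N)) //= big1 => [|i /eqP hi].
    by rewrite expr1n mul1r expr1 coefMn coefXn eqxx bin1 addr0.
  rewrite expr1n mul1r -exprM coefMn coefXn -{1}[(p ^ s)%N]muln1 eqn_pmul2l //.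
  by case: eqP => [E|_]; [case: hi; apply: val_inj | rewrite mul0rn].
by rewrite (dvdn_pcharf pF) key -(dvdn_pcharf pF).
Qed.

(** * Integers in the residue field and unit binomial coefficients *)

Section ResidueCharacteristic.
Variables (F : fieldType) (V : ordQspaceType) (nu : valuation F V).

Lemma val_nat_ge0 n : vle 0%:E (nu n%:R).
Proof.
elim: n => [|n IHn]; first by rewrite val0.
by rewrite mulrS; apply: val_leD => //; rewrite Defs.val1 vle_refl.
Qed.

Lemma val_nat_eq0 n : ~~ vlt 0%:E (nu n%:R) -> nu n%:R = 0%:E.
Proof.
move=> /negbNE h; apply: vle_anti; apply/andP; split=> //; exact: val_nat_ge0.
Qed.

Lemma residue_nat_eq0 n :
  ((n%:R : residue_field nu) == 0) = vlt 0%:E (nu n%:R).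
Proof.
have -> : (n%:R : residue_field nu) = \pi_(residue_field nu)%qT (n%:R : valuation_ring nu).
  by rewrite rmorph_nat.
rewrite -(rmorph0 \pi_(residue_field nu)%qT) -Quotient.idealrBE subr0 unfold_in.
rewrite /max_ideal.
by rewrite (_ : vring_val _ = n%:R) //; exact: (rmorph_nat (val : valuation_ring nu -> F)).
Qed.

Lemma val_prime_pchar l : prime l -> vlt 0%:E (nu l%:R) ->
  l \in [pchar (residue_field nu)].
Proof. by move=> lp h; apply/andP; split=> //=; rewrite residue_nat_eq0. Qed.

(** Natural numbers have value at least 0, so a product of them has positive value only if some
    factor has; split off the smallest prime divisor. *)
Lemma val_nat_pchar n : (0 < n)%N -> vlt 0%:E (nu n%:R) ->
  exists2 l, l \in [pchar (residue_field nu)] & (l %| n)%N.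
Proof.
elim/ltn_ind: n => n IHn n0 hn.
have n1 : (1 < n)%N.
  case: n n0 hn {IHn} => [|[|n]] // _.
  by rewrite Defs.val1 /vlt vle_refl.
case: (boolP (vlt 0%:E (nu (pdiv n)%:R))) => h.
  by exists (pdiv n); [apply: val_prime_pchar; first exact: pdiv_prime | exact: pdiv_dvd].
have [||| l hl hln] := IHn (n %/ pdiv n)%N.
- by apply: ltn_Pdiv => //; apply: prime_gt1; apply: pdiv_prime.
- by rewrite divn_gt0 ?pdiv_gt0 // dvdn_leq ?pdiv_dvd.
- have e0 := val_nat_eq0 h; move: hn; rewrite -{1}(divnK (pdiv_dvd n)) natrM Defs.valM e0.
  by case: (nu (n %/ pdiv n)%:R) => [r||] //=; rewrite /adde /= addr0.
by exists l => //; apply: dvdn_trans hln (dvdn_div _); exact: pdiv_dvd.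
Qed.

(** In residue characteristic 0 every positive integer has value 0 and [e = 0] works. Otherwise
    [p ^ e] is the exact power of [p] dividing [j], and [prime_ndvd_bin_expn] applies. *)
Lemma val_unit_bin p j : char_exponent (residue_field nu) p -> (0 < j)%N ->
  exists e, (p ^ e <= j)%N /\ nu 'C(j, p ^ e)%:R = 0%:E.
Proof.
move=> [pp|[p0 ->]] j0; last first.
  exists 0%N; split=> //; apply: val_nat_eq0; apply/negP => /val_nat_pchar.
  by rewrite bin1 => /(_ j0)[l]; rewrite p0.
have p_pr : prime p by case/andP: pp.
exists (logn p j); have le : (p ^ logn p j <= j)%N.
  by apply: dvdn_leq => //; apply: pfactor_dvdnn.
split=> //; apply: val_nat_eq0; apply/negP => /val_nat_pchar.
rewrite bin_gt0 => /(_ le)[l]; rewrite (pcharf_eq pp) => /eqP ->.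
apply/negP; have [u pu ju] := pfactor_coprime p_pr j0.
rewrite {1}ju mulnC; apply: prime_ndvd_bin_expn => //.
by rewrite -prime_coprime.
Qed.

End ResidueCharacteristic.

(** * The lexicographic filtration of an abstract key polynomial *)

Section LexFiltration.
Variables (K : fieldType) (V : ordQspaceType).
Variable nu : valuation {fraction {poly K}} V.
Implicit Types (f g h a : {poly K}) (v w : V) (c : {poly {poly K}}).

Local Notation small Q f := (size (f : {poly K}) < size (Q : {poly K}))%N.
Local Notation ge := (pval_ge nu).
Local Notation gt := (pval_gt nu).
Local Notation eqv := (pval_eqv nu).

(** [eps] is the largest slope of [Q] and [q] the smallest order attaining it, stated on values so
    that no division occurs. [ak_small] says that polynomials of smaller degree have all slopes
    below [eps]; an arbitrary lower bound [v] replaces the value so that zero is covered. *)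
Record abstract_key (Q : {poly K}) (beta eps : V) (q : nat) : Prop := AbstractKey {
  ak_monic : Q \is monic;
  ak_size : (1 < size Q)%N;
  ak_val : eqv Q beta;
  ak_ge : forall n, ge (beta - eps *+ n) Q^`N(n);
  ak_q0 : (0 < q)%N;
  ak_eqv : eqv Q^`N(q) (beta - eps *+ q);
  ak_gt : forall n, (0 < n < q)%N -> gt (beta - eps *+ n) Q^`N(n);
  ak_small : forall f v n, (size f < size Q)%N -> (0 < n)%N -> ge v f ->
    gt (v - eps *+ n) f^`N(n)
}.

(** Every term of the [Q]-expansion has (value, exponent) at least [(v, k)] in lexicographic order.
    For [k = 0] this bounds the truncation at [Q] from below by [v]. *)
Definition lex (Q : {poly K}) v (k : nat) f :=
  exists c, [/\ f = c.[Q], forall i, small Q (c`_i)%R,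
    forall i, ge v (c`_i * Q ^+ i)
    & forall i, (i < k)%N -> gt v (c`_i * Q ^+ i)].

(** The constant coefficient is the remainder modulo [Q], hence zero; then cancel a factor [Q] and
    repeat. *)
Lemma expansion_eq0 (Q : {poly K}) c : Q \is monic ->
  (forall i, small Q (c`_i)%R) -> c.[Q] = 0 -> c = 0.
Proof.
move=> Qm; elim/poly_ind: c => [|c e IHc] // hc; rewrite hornerMXaddC => E.
have he : small Q e by have := hc 0%N; rewrite coefD coefMX coefC add0r.
have e0 : e = 0 by rewrite -(modp_addl_mul_small c.[Q] he) E mod0p.
move: E; rewrite e0 addr0 => /eqP; rewrite mulf_eq0 (negbTE (monic_neq0 Qm)) orbF.
move=> /eqP /IHc -> //; first by rewrite mul0r addr0.
by move=> i; have := hc i.+1; rewrite coefD coefMX coefC /= addr0.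
Qed.

Lemma expansion_uniq (Q : {poly K}) c c' : Q \is monic ->
  (forall i, small Q (c`_i)%R) -> (forall i, small Q (c'`_i)%R) ->
  c.[Q] = c'.[Q] -> c = c'.
Proof.
move=> Qm hc hc' E; apply/eqP; rewrite -subr_eq0; apply/eqP.
apply: (expansion_eq0 Qm) => [i|]; last by rewrite hornerD hornerN E subrr.
by rewrite coefB (leq_ltn_trans (size_polyD _ _)) // gtn_max hc size_polyN hc'.
Qed.

(** Iterated Euclidean division. The count of terms serves later with [n = alpha l], when [Q l] has
    [alpha l] times the degree of the previous key. *)
Lemma expansion_exists (Q : {poly K}) n f : Q \is monic -> (1 < size Q)%N ->
  (size f <= n * (size Q).-1)%N ->
  exists c, [/\ f = c.[Q], forall i, small Q (c`_i)%R & (size c <= n)%N].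
Proof.
move=> Qm Q1; elim: n f => [|n IHn] f hf.
  exists 0; split; first by rewrite horner0; apply/eqP; rewrite -size_poly_leq0.
    by move=> i; rewrite coef0 size_poly0; apply: ltnW.
  by rewrite size_poly0.
have [|c [E hc sc]] := IHn (f %/ Q).
  by rewrite size_divp ?monic_neq0 // leq_subLR -mulSn.
exists (c * 'X + (f %% Q)%:P); split.
- by rewrite hornerMXaddC -E -divp_eq.
- case=> [|i]; rewrite coefD coefMX coefC ?add0r ?addr0 //=.
  by rewrite ltn_modp monic_neq0.
- rewrite (leq_trans (size_polyD _ _)) // geq_max (leq_trans (size_polyC_leq1 _)) //.
  rewrite andbT; have [->|c0] := eqVneq c 0; first by rewrite mul0r size_poly0.
  by rewrite size_mulX.
Qed.

Section FixedKey.
Variables (Q : {poly K}) (beta eps : V) (q : nat).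
Hypothesis key : abstract_key Q beta eps q.

Let Qmon := ak_monic key.
Let Q_gt1 := ak_size key.

Lemma small0 : small Q 0%R.
Proof. by rewrite size_poly0 ltnW. Qed.

Lemma small_const (x : K) : small Q (x%:P)%R.
Proof. exact: leq_ltn_trans (size_polyC_leq1 x) Q_gt1. Qed.

Lemma small_nderivn f n : small Q f -> small Q (f^`N(n))%R.
Proof. by apply: leq_ltn_trans; rewrite /nderivn (leq_trans (size_poly _ _)) ?leq_subr. Qed.

Lemma small_nderivn_key n : (0 < n)%N -> small Q (Q^`N(n))%R.
Proof. by move=> n0; apply: size_nderivn_lt => //; exact: monic_neq0 Qmon. Qed.

Lemma lex_le v k f w m : qle w v -> (m <= k)%N -> lex Q v k f -> lex Q w m f.
Proof.
move=> wv mk [c [E hc h1 h2]]; exists c; split=> // i; first exact: ge_le (h1 i).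
by move=> im; apply: gt_le (h2 i (leq_trans im mk)).
Qed.

Lemma lex_lt v k f w m : qlt w v -> lex Q v k f -> lex Q w m f.
Proof.
move=> wv [c [E hc h1 h2]]; exists c; split=> // i.
  by apply: ge_le (h1 i); apply: qltW.
by move=> _; apply: gt_lt (h1 i).
Qed.

Lemma lex_zero v k : lex Q v k 0.
Proof.
exists 0; split; first by rewrite horner0.
- by move=> i; rewrite coef0 small0.
- by move=> i; rewrite coef0 mul0r; apply: ge0.
- by move=> i _; rewrite coef0 mul0r; apply: gt0.
Qed.

Lemma lexD v k f g : lex Q v k f -> lex Q v k g -> lex Q v k (f + g).
Proof.
move=> [c [-> hc h1 h2]] [e [-> he k1 k2]]; exists (c + e); split.
- by rewrite hornerD.
- by move=> i; rewrite coefD (leq_ltn_trans (size_polyD _ _)) // gtn_max hc he.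
- by move=> i; rewrite coefD mulrDl; apply: geD.
- by move=> i ik; rewrite coefD mulrDl; apply: gtD; [apply: h2 | apply: k2].
Qed.

Lemma lexN v k f : lex Q v k f -> lex Q v k (- f).
Proof.
move=> [c [-> hc h1 h2]]; exists (- c); split.
- by rewrite hornerN.
- by move=> i; rewrite coefN size_polyN.
- by move=> i; rewrite coefN mulNr geN.
- by move=> i ik; rewrite coefN mulNr gtN; apply: h2.
Qed.

Lemma lex_sum (I : Type) (r : seq I) (P : pred I) (F : I -> {poly K}) v k :
  (forall i, P i -> lex Q v k (F i)) -> lex Q v k (\sum_(i <- r | P i) F i).
Proof.
by move=> h; apply: (big_ind (lex Q v k)) => //; [exact: lex_zero | move=> *; apply: lexD].
Qed.

Lemma lex_term v k a n : small Q a -> ge v (a * Q ^+ n) ->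
  ((n < k)%N -> gt v (a * Q ^+ n)) -> lex Q v k (a * Q ^+ n).
Proof.
move=> sa h1 h2; exists (a%:P * 'X^n); split.
- by rewrite hornerCM hornerXn.
- by move=> i; rewrite coefCM coefXn; case: eqP; rewrite ?mulr1 // mulr0 small0.
- move=> i; rewrite coefCM coefXn; case: eqP => [->|_]; rewrite ?mulr1 //.
  by rewrite mulr0 mul0r; apply: ge0.
- move=> i; rewrite coefCM coefXn; case: eqP => [->|_]; rewrite ?mulr1 //.
  by rewrite mulr0 mul0r => _; apply: gt0.
Qed.

Lemma lex_small v a : small Q a -> ge v a -> lex Q v 0 a.
Proof. by move=> sa ha; rewrite -[a]mulr1 -(expr0 Q); apply: lex_term; rewrite ?expr0 ?mulr1. Qed.

Lemma lex_small_gt v k a : small Q a -> gt v a -> lex Q v k a.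
Proof.
move=> sa ha; rewrite -[a]mulr1 -(expr0 Q); apply: lex_term; rewrite ?expr0 ?mulr1 //.
exact: gt_ge.
Qed.

Lemma lex_ge v k f : lex Q v k f -> ge v f.
Proof. by move=> [c [-> _ h _]]; rewrite horner_coef; apply: ge_sum. Qed.

(** By uniqueness a single term is its own expansion, so its exponent is its exact position in the
    filtration. All contradictions about positions come from here. *)
Lemma lex_nterm v k a n : small Q a -> eqv (a * Q ^+ n) v -> (n < k)%N ->
  ~ lex Q v k (a * Q ^+ n).
Proof.
move=> sa hv nk [c [E hc _ h2]]; have : c = a%:P * 'X^n.
  apply: (expansion_uniq Qmon) => //; last by rewrite -E hornerCM hornerXn.
  by move=> i; rewrite coefCM coefXn; case: eqP; rewrite ?mulr1 // mulr0 small0.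
move=> Ec; have := h2 n nk; rewrite Ec coefCM coefXn eqxx mulr1.
exact/negP/eqv_ngt.
Qed.

(* Otherwise [l * Q] would have all its slopes below [eps], like [a * a'] and
   [r]; but [Q] divides it. *)
Lemma mul_small v w a a' : small Q a -> small Q a' -> ge v a -> ge w a' ->
  exists l r, [/\ a * a' = l * Q + r, small Q l, small Q r,
                  ge (v + w) r & gt (v + w) (l * Q)].
Proof.
move=> sa sa' ha ha'; pose F := a * a'; pose l := F %/ Q; pose r := F %% Q.
have EF : F = l * Q + r by exact: divp_eq.
have sr : small Q r by rewrite ltn_modp monic_neq0.
have sl : small Q l.
  rewrite size_divp ?monic_neq0 //; apply: leq_ltn_trans (leq_sub2r _ (size_polyMleq _ _)) _.
  move: sa sa' Q_gt1 {sr EF r l F ha ha'}; move: (size a) (size a') (size Q).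
  by move=> x y z; lia.
have hF : ge (v + w) F by exact: geM.
have gl : gt (v + w) (l * Q).
  apply: contrapT => /negP ngl.
  have [la hla] : exists la, eqv (l * Q) la.
    by apply: pval_fin; apply: contraNneq ngl => ->; apply: gt0.
  have lela : qle la (v + w) by move: ngl; rewrite (eqv_gtE _ hla) /qlt negbK.
  have hr : ge la r.
    have -> : r = F - l * Q by rewrite EF addrC addKr.
    by apply: geD; [exact: ge_le hF | rewrite geN; exact: eqv_ge].
  have l0 : l != 0 by have := eqv_neq0 hla; rewrite mulf_eq0 negb_or => /andP[].
  have [vl hl] := pval_fin nu l0.
  have vlE : la = vl + beta.
    by apply: eqv_inj hla _; apply: eqvM hl (ak_val key).
  have q0 := ak_q0 key.
  have gF : gt (la - eps *+ q) F^`N(q).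
    apply: (@gt_le _ _ _ _ (v + w - eps *+ q)); first by rewrite qleD2r.
    (* Since [q > 0], each Leibniz term differentiates at least one of [a], [a'], and this factor
       gains value by [ak_small]. *)
    rewrite nderivnM; apply: gt_sum => k _.
    have -> : v + w - eps *+ q = (v - eps *+ k) + (w - eps *+ (q - k)).
      by rewrite addrACA -opprD -mulrnDr subnKC // -ltnS.
    have [k0|k0] := posnP k.
      rewrite k0 nderivn0 mulr0n subr0 subn0; apply: gtMr => //.
      exact: (ak_small key).
    apply: gtMl; first exact: (ak_small key).
    have [->|k1] := posnP (q - k); first by rewrite mulr0n subr0 nderivn0.
    by apply: gt_ge; apply: (ak_small key).
  have gr : gt (la - eps *+ q) r^`N(q) by exact: (ak_small key).
  have : gt (la - eps *+ q) (l * Q)^`N(q).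
    have -> : l * Q = F - r by rewrite EF addrK.
    by rewrite linearB; apply: gtD => //; rewrite gtN.
  (* Differentiating only [Q] gives value exactly [la - eps *+ q]; the Leibniz terms that
     differentiate [l] have larger value. *)
  apply/negP/eqv_ngt; rewrite nderivnM big_ord_recl /= nderivn0 subn0.
  apply: eqvDr; first by rewrite vlE -addrA; apply: eqvM => //; exact: ak_eqv key.
  apply: gt_sum => k _; rewrite /bump add1n.
  have -> : la - eps *+ q = (vl - eps *+ k.+1) + (beta - eps *+ (q - k.+1)).
    by rewrite addrACA -opprD -mulrnDr subnKC // vlE.
  by apply: gtMl; [apply: (ak_small key) => //; exact: eqv_ge | exact: ak_ge key _].
exists l, r; split=> //.
have -> : r = F - l * Q by rewrite EF addrC addKr.
by apply: geD => //; rewrite geN; apply: gt_ge.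
Qed.

End FixedKey.
End LexFiltration.

(** * Multiplicativity of the filtration and its behaviour under Hasse derivatives *)

Section LexProducts.
Variables (K : fieldType) (V : ordQspaceType).
Variable nu : valuation {fraction {poly K}} V.
Implicit Types (f g h a : {poly K}) (v w : V) (c : {poly {poly K}}).

Local Notation small Q f := (size (f : {poly K}) < size (Q : {poly K}))%N.
Local Notation ge := (pval_ge nu).
Local Notation gt := (pval_gt nu).
Local Notation eqv := (pval_eqv nu).
Variables (Q : {poly K}) (beta eps : V) (q : nat).
Hypothesis key : abstract_key nu Q beta eps q.

Let Q_gt1 : (1 < size Q)%N := ak_size key.
Local Notation lex := (lex nu Q).

Lemma lexMkey v k f : lex v k f -> lex (v + beta) k.+1 (f * Q).
Proof.
move=> [c [-> hc h1 h2]]; exists (c * 'X); split.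
- by rewrite hornerMX.
- by move=> [|i]; rewrite coefMX //=; exact: small0 key.
- move=> [|i]; rewrite coefMX /=; first by rewrite mul0r; apply: ge0.
  by rewrite exprSr mulrA; apply: geM (h1 i) (eqv_ge (ak_val key)).
- move=> [|i]; rewrite coefMX /=; first by rewrite mul0r => _; apply: gt0.
  by rewrite ltnS => ik; rewrite exprSr mulrA; apply: gtMl (h2 i ik) (eqv_ge (ak_val key)).
Qed.

Lemma lexMkeyX v k n f : lex v k f -> lex (v + beta *+ n) (k + n) (f * Q ^+ n).
Proof.
move=> h; elim: n => [|n IHn]; first by rewrite mulr0n addr0 addn0 expr0 mulr1.
by rewrite mulrSr addrA exprSr mulrA addnS; apply: lexMkey.
Qed.

Lemma eqv_term a u n : eqv a u -> eqv (a * Q ^+ n) (u + beta *+ n).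
Proof. by move=> h; apply: eqvM h (eqvX _ (ak_val key)). Qed.

(** Write the product of [a] with the [i]-th coefficient as [l * Q + r]: the part [r] stays at
    exponent [i], and [l * Q] moves to exponent [i + 1] with strictly larger value. *)
Lemma lex_mul_small v w k a f : small Q a -> ge w a -> lex v k f ->
  lex (w + v) k (a * f).
Proof.
move=> sa ha [c [-> hc h1 h2]]; rewrite horner_coef mulr_sumr.
apply: (lex_sum key) => i _; have [->|c0] := eqVneq (c`_i) 0.
  by rewrite mul0r mulr0; apply: lex_zero key _ _.
have [u hu] := pval_fin nu c0; have hui := eqv_term i hu.
have [l [r [E sl sr hr hl]]] := mul_small key sa (hc i) ha (eqv_ge hu).
have vu : qle v (u + beta *+ i) by rewrite -(eqv_geE _ hui).
have ivu : (i < k)%N -> qlt v (u + beta *+ i) by move=> ik; rewrite -(eqv_gtE _ hui) h2.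
have hQi := eqv_ge (eqvX i (ak_val key)).
rewrite mulrA E mulrDl -mulrA -exprS.
apply: lexD; last first.
  have hri : ge (w + u + beta *+ i) (r * Q ^+ i) by exact: geM.
  apply: (lex_term key) => //.
    by apply: ge_le hri; rewrite -addrA ![w + _]addrC qleD2r.
  by move=> ik; apply: gt_lt hri; rewrite -addrA ![w + _]addrC qltD2r ivu.
have hli : gt (w + v) (l * Q ^+ i.+1).
  rewrite exprS mulrA; apply: gt_le (gtMl hl hQi).
  by rewrite -addrA ![w + _]addrC qleD2r.
by apply: (lex_term key) => //; exact: gt_ge.
Qed.

Lemma lexM v w k m f g : lex v k f -> lex w m g -> lex (v + w) (k + m) (f * g).
Proof.
move=> hf [c [-> hc h1 h2]]; rewrite horner_coef mulr_sumr.
apply: (lex_sum key) => i _; have [->|c0] := eqVneq (c`_i) 0.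
  by rewrite mul0r mulr0; apply: lex_zero key _ _.
have [u hu] := pval_fin nu c0; have hui := eqv_term i hu.
have hfc : lex (u + beta *+ i + v) (k + i) (f * (c`_i * Q ^+ i)).
  rewrite mulrA [f * _]mulrC addrAC; apply: lexMkeyX.
  exact: lex_mul_small (hc i) (eqv_ge hu) hf.
(* A term of [g] of exponent at least [m] shifts far enough; one of exponent below [m] has value
   above [w], which outweighs any loss in the exponent. *)
rewrite [v + w]addrC; case: (leqP m i) => im.
  by apply: lex_le hfc; rewrite ?leq_add2l // qleD2r -(eqv_geE _ hui).
by apply: lex_lt hfc; rewrite qltD2r -(eqv_gtE _ hui) h2.
Qed.

(* All Hasse derivatives of [f] are as large as those of a term of value [v]
   divisible by [Q ^+ j]: differentiating [q] times costs one factor [Q]. *)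
Definition lex_nderivn v j f :=
  forall n, lex (v - eps *+ n) (j - n %/ q) f^`N(n).

(** Leibniz' rule together with [k %/ q + (n - k) %/ q <= n %/ q]: distributing the order over two
    factors costs no more powers of [Q] than the bound allows. *)
Lemma lex_nderivnM v w j i f g : lex_nderivn v j f -> lex_nderivn w i g ->
  lex_nderivn (v + w) (j + i) (f * g).
Proof.
move=> hf hg n; rewrite nderivnM; apply: (lex_sum key) => -[k /= kn] _.
apply: lex_le (lexM (hf k) (hg (n - k)%N)).
  by rewrite addrACA -opprD -mulrnDr subnKC // qle_refl.
have := divnD k (n - k) (ak_q0 key); rewrite subnKC //.
by move: (k %/ q)%N ((n - k) %/ q)%N (n %/ q)%N => x y z; lia.
Qed.

Lemma lex_nderivn_small v a : small Q a -> ge v a -> lex_nderivn v 0 a.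
Proof.
move=> sa ha [|n]; first by rewrite mulr0n subr0 nderivn0; apply: (lex_small key).
apply: (lex_small key); first exact: (small_nderivn _ sa).
by apply/gt_ge/(ak_small key).
Qed.

(** For [0 < n < q] the derivative has value strictly above the bound, which makes its exponent
    irrelevant; for [n >= q] the required exponent is 0. *)
Lemma lex_nderivn_key : lex_nderivn beta 1 Q.
Proof.
move=> n; have [->|n0] := posnP n.
  rewrite div0n mulr0n subr0 nderivn0 -[Q in lex _ _ Q]mul1r -[Q in 1 * Q]expr1.
  apply: (lex_term key) => //; first by rewrite size_poly1.
  by rewrite mul1r expr1; apply/eqv_ge/(ak_val key).
have sQ := small_nderivn_key key n0.
case: (ltnP n q) => nq.
  by apply: (lex_small_gt key) => //; apply: (ak_gt key); rewrite n0.
have -> : (1 - n %/ q = 0)%N.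
  by apply/eqP; rewrite subn_eq0 divn_gt0 ?(ak_q0 key).
by apply: (lex_small key) => //; exact: ak_ge key _.
Qed.

Lemma lex_nderivn_keyX j : lex_nderivn (beta *+ j) j (Q ^+ j).
Proof.
elim: j => [|j IHj]; last first.
  by rewrite mulrS exprS -add1n; apply: lex_nderivnM => //; exact: lex_nderivn_key.
rewrite mulr0n expr0; apply: lex_nderivn_small; first by rewrite size_poly1.
exact/eqv_ge/pval1.
Qed.

Lemma lex_nderivn_term u a j : small Q a -> ge u a ->
  lex_nderivn (u + beta *+ j) j (a * Q ^+ j).
Proof.
move=> sa ha; rewrite -[j in lex_nderivn _ j]add0n; apply: lex_nderivnM.
  exact: lex_nderivn_small.
exact: lex_nderivn_keyX.
Qed.

(** Where truncation and value agree, this bounds the slopes of [f] by [eps]; a later key polynomial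
    has a larger [eps], whence its [ak_small]. *)
Lemma lex_ge_nderivn v f n : lex v 0 f -> ge (v - eps *+ n) f^`N(n).
Proof.
move=> [c [-> hc h1 _]]; rewrite horner_coef linear_sum.
apply: ge_sum => i _ /=; have [->|c0] := eqVneq (c`_i) 0.
  by rewrite mul0r linear0; apply: ge0.
have [u hu] := pval_fin nu c0.
apply: ge_le (lex_ge (lex_nderivn_term i (hc i) (eqv_ge hu) n)).
by rewrite qleD2r -(eqv_geE _ (eqv_term i hu)).
Qed.

(** The dominant way to distribute the order [m * q] over [j] factors [Q] differentiates [m] of them
    [q] times each. An order strictly between 0 and [q] on a factor gains value; an order above [q]
    leaves too little to use up [m - 1] of the other factors. *)
Lemma nderivn_keyX j m :
  lex (beta *+ j - eps *+ (m * q)) (j.+1 - m)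
    ((Q ^+ j)^`N(m * q) - (Q^`N(q) ^+ m * Q ^+ (j - m)) *+ 'C(j, m)).
Proof.
elim: j m => [|j IHj] [|m].
- rewrite mul0n nderivn0 !subn0 bin0 !expr0 mulr1 mulr1n !subrr; apply: (lex_zero key).
- rewrite bin0n mulr0n subr0 expr0 -(polyC1 K) nderivnC muln_eq0 /=.
  by rewrite eqn0Ngt (ak_q0 key); apply: lex_zero key _ _.
- by rewrite mul0n nderivn0 !subn0 bin0 expr0 mul1r mulr1n subrr; apply: lex_zero key _ _.
have q0 := ak_q0 key.
pose D k := Q^`N(k) * (Q ^+ j)^`N(m.+1 * q - k).
have kq : (q < (m.+1 * q).+1)%N by rewrite ltnS mulSn leq_addr.
have -> : (Q ^+ j.+1)^`N(m.+1 * q) = D 0%N + D q +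
    \sum_(k < (m.+1 * q).+1 | (k != 0 :> nat) && (k != q :> nat)) D k.
  rewrite exprS nderivnM (bigD1 ord0) //= (bigD1 (Ordinal kq)) /=; last first.
    by rewrite -val_eqE /= -lt0n.
  by rewrite addrA; congr (_ + _); apply: eq_bigl => k; rewrite -!val_eqE.
(* Pascal's rule splits the main term into two: one is matched by [D 0], where the new factor is not
   differentiated, the other by [D q]. *)
set X := _ * Q ^+ (j.+1 - m.+1); rewrite binS [X *+ (_ + _)]mulrnDr.
have D0 : D 0%N - X *+ 'C(j, m.+1) =
    Q * ((Q ^+ j)^`N(m.+1 * q) - (Q^`N(q) ^+ m.+1 * Q ^+ (j - m.+1)) *+ 'C(j, m.+1)).
  rewrite mulrBr /D nderivn0 subn0; congr (_ - _); rewrite mulrnAr /X.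
  (* When [j <= m] the truncated subtractions do not match, but the binomial is zero. *)
  case: (ltnP j m.+1) => jm; first by rewrite bin_small ?mulr0n.
  by rewrite mulrCA -exprS subSn.
have Dq : D q - X *+ 'C(j, m) =
    Q^`N(q) * ((Q ^+ j)^`N(m * q) - (Q^`N(q) ^+ m * Q ^+ (j - m)) *+ 'C(j, m)).
  rewrite mulrBr /D mulSn addKn; congr (_ - _).
  by rewrite mulrnAr /X subSS mulrA -exprS.
rewrite [Y in lex _ _ Y]addrAC [- (X *+ _ + _)]opprD [Y in lex _ _ (Y + _)]addrACA D0 Dq.
have Ev k : (k <= m.+1 * q)%N -> beta *+ j.+1 - eps *+ (m.+1 * q) =
    (beta - eps *+ k) + (beta *+ j - eps *+ (m.+1 * q - k)).
  by move=> km; rewrite addrACA -opprD -mulrnDr subnKC // -mulrS.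
have HQ : lex beta 1 Q.
  by have := lex_nderivn_key 0; rewrite div0n mulr0n subr0 nderivn0.
apply: lexD; first apply: lexD.
- rewrite (Ev 0%N) // mulr0n subr0 subn0.
  by apply: lex_le (lexM HQ (IHj m.+1)); [exact: qle_refl | lia].
- rewrite (Ev q) // mulSn addKn.
  have hq : lex (beta - eps *+ q) 0 Q^`N(q).
    exact (lex_small key (small_nderivn_key key q0) (ak_ge key q)).
  by apply: lex_le (lexM hq (IHj m)); [exact: qle_refl | lia].
apply: (lex_sum key) => -[k /= hk] /andP[k0 kNq].
rewrite -lt0n in k0; rewrite ltnS in hk; rewrite (Ev k) //.
have sk := small_nderivn_key key k0; have hj := lex_nderivn_keyX j (m.+1 * q - k)%N.
case: (ltngtP k q) kNq => // kq' _.
  have hk' : lex (beta - eps *+ k) (j.+2 - m.+1) Q^`N(k).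
    by apply: (lex_small_gt key) => //; apply: (ak_gt key); rewrite k0.
  by apply: lex_le (lexM hk' hj); [exact: qle_refl | lia].
have hk' : lex (beta - eps *+ k) 0 Q^`N(k).
  by apply: (lex_small key) => //; exact: ak_ge key _.
apply: lex_le (lexM hk' hj); first exact: qle_refl.
have : ((m.+1 * q - k) %/ q < m)%N by rewrite ltn_divLR // ltn_subLR // mulSn ltn_add2r.
by move: (_ %/ q)%N => x; lia.
Qed.

(** The [j]-th term contributes a term of value exactly [B] at exponent [j - s]. Everything else
    lies in the step [(B, k)]: terms of exponent above [j] keep an exponent above [j - s], and those
    of exponent strictly between 0 and [j] have larger value from the start. *)
Lemma nderivn_nlex c v j s :
  (forall i, small Q (c`_i)%R) -> (forall i, ge v (c`_i * Q ^+ i)) ->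
  (0 < j)%N -> eqv (c`_j * Q ^+ j) v ->
  (forall i, (0 < i < j)%N -> gt v (c`_i * Q ^+ i)) ->
  (0 < s <= j)%N -> eqv 'C(j, s)%:R 0 ->
  ~ lex (v - eps *+ (s * q)) (j - s).+1 (c.[Q])^`N(s * q).
Proof.
move=> hc hv j0 hj hlt /andP[s0 sj] hbin.
set B := v - _; set k := (j - s).+1 => hlex.
have q0 := ak_q0 key; have sq0 : (0 < s * q)%N by rewrite muln_gt0 s0.
have cj0 : c`_j != 0 by have := eqv_neq0 hj; rewrite mulf_eq0 negb_or => /andP[].
have [u hu] := pval_fin nu cj0.
have vE : v = u + beta *+ j by exact: eqv_inj hj (eqv_term j hu).
have jc : (j < size c)%N by apply: contraNltn cj0 => h; rewrite nth_default.
(* From the supposed membership subtract whatever lies in the step [(B, k)], beginning with the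
   terms of exponent other than [j]. *)
have hmain : lex B k (c`_j * Q ^+ j)^`N(s * q).
  move: hlex; rewrite horner_coef linear_sum (bigD1 (Ordinal jc)) //=.
  set S := \sum_(i < _ | _) _ => h.
  rewrite -[X in lex _ _ X](addrK S); apply: lexD h _; apply: lexN.
  apply: (lex_sum key) => -[i /= ic]; rewrite -val_eqE /= => ij.
  have [->|c0] := eqVneq (c`_i) 0.
    by rewrite mul0r linear0; apply: lex_zero key _ _.
  have [ui hui] := pval_fin nu c0; have huit := eqv_term i hui.
  have ht := lex_nderivn_term i (hc i) (eqv_ge hui) (s * q).
  have vi : qle v (ui + beta *+ i) by rewrite -(eqv_geE _ huit).
  (* The term of exponent 0 may have value [v], but its derivative gains value by [ak_small]. *)
  have [i0|i0] := posnP i.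
    subst i; have := hv 0%N; rewrite !expr0 !mulr1 => hv0.
    apply: (lex_small_gt key); first exact: (small_nderivn _ (hc 0%N)).
    exact: (ak_small key).
  case: (ltngtP i j) ij => // ij _.
    apply: lex_lt ht; rewrite qltD2r -(eqv_gtE _ huit); apply: hlt.
    by rewrite i0.
  by apply: lex_le ht; rewrite ?qleD2r // mulnK // /k; lia.
(* Next remove the Leibniz terms that differentiate the coefficient; they gain value by
   [ak_small]. *)
have {}hmain : lex B k (c`_j * (Q ^+ j)^`N(s * q)).
  move: hmain; rewrite nderivnM big_ord_recl /= nderivn0 subn0.
  set S := \sum_(i < _) _ => h; rewrite -[X in lex _ _ X](addrK S).
  apply: lexD h _; apply: lexN; apply: (lex_sum key) => i _.
  rewrite /bump add1n /B vE.
  have -> : u + beta *+ j - eps *+ (s * q) =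
      (u - eps *+ i.+1) + (beta *+ j - eps *+ (s * q - i.+1)).
    by rewrite addrACA -opprD -mulrnDr subnKC.
  have h1 : lex (u - eps *+ i.+1) k (c`_j)^`N(i.+1).
    apply: (lex_small_gt key); first exact: (small_nderivn _ (hc j)).
    by apply: (ak_small key) => //; exact: eqv_ge.
  by apply: lex_le (lexM h1 (lex_nderivn_keyX j _)); [exact: qle_refl | exact: leq_addr].
(* By [nderivn_keyX] only this coefficient of [Q ^+ (j - s)] remains; it need not be small, so it
   still has to be reduced modulo [Q]. *)
pose main := 'C(j, s)%:R * (Q^`N(q) ^+ s * c`_j).
have {}hmain : lex B k (main * Q ^+ (j - s)).
  have E := lex_mul_small (hc j) (eqv_ge hu) (nderivn_keyX j s).
  rewrite addrA -vE -/B subSn // -/k mulrBr in E.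
  have := lexD hmain (lexN E); rewrite opprB addrC subrK.
  rewrite /main -mulr_natl mulrCA => H; move: H; congr (lex _ _ _).
  by rewrite -!mulrA; congr (_ * _); rewrite mulrCA.
(* Multiplication by a small polynomial of known value keeps the value of the remainder exact and
   moves the rest to exponent at least 1. As [main] is a product of small polynomials, this is
   applied factor by factor. *)
have exact_mul a f w z : small Q a -> eqv a w ->
    (exists r h, [/\ f = r + h, small Q r, eqv r z & lex z 1 h]) ->
    (exists r h, [/\ a * f = r + h, small Q r, eqv r (w + z) & lex (w + z) 1 h]).
  move=> sa ha [r [h [-> sr hr hh]]].
  have [l [r' [E sl sr' _ hl]]] := mul_small key sa sr (eqv_ge ha) (eqv_ge hr).
  exists r', (l * Q + a * h); split => //.
  - by rewrite mulrDr E [l * Q + r']addrC addrA.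
  - have -> : r' = a * r - l * Q by rewrite E addrC addKr.
    by apply: eqvDr; [exact: eqvM | rewrite gtN].
  apply: lexD; last exact: lex_mul_small (eqv_ge ha) hh.
  rewrite -[Q in l * Q]expr1; apply: (lex_term key) => //; rewrite expr1 //.
  exact: gt_ge.
have [r [h [mE sr hr hh]]] : exists r h, [/\ main = r + h, small Q r,
    eqv r (0 + ((beta - eps *+ q) *+ s + u))
    & lex (0 + ((beta - eps *+ q) *+ s + u)) 1 h].
  apply: (exact_mul) => //; first by rewrite -polyC_natr; exact: small_const key _.
  move: exact_mul; clear -key hu hc; move=> exact_mul; elim: s => [|s IHs].
    rewrite expr0 mul1r mulr0n add0r; exists c`_j, 0; split=> //; first by rewrite addr0.
    exact: lex_zero key _ _.
  rewrite exprS -mulrA mulrS -addrA; apply: (exact_mul) IHs.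
    exact (small_nderivn_key key (ak_q0 key)).
  exact: ak_eqv key.
have BE : 0 + ((beta - eps *+ q) *+ s + u) + beta *+ (j - s) = B.
  rewrite add0r /B vE mulrnBl -mulrnA [(q * s)%N]mulnC -[in RHS](subnKC sj) mulrnDr.
  by rewrite [_ - _ + u]addrC -addrA [_ - _ + _]addrAC !addrA.
apply: (@lex_nterm _ _ nu Q beta eps q key B k r (j - s)) => //.
  by rewrite -BE; exact: eqv_term.
have := lexMkeyX (j - s) hh; rewrite BE add1n -/k => hh'.
have := lexD hmain (lexN hh'); rewrite mE mulrDl addrK //.
Qed.

Lemma slope_increase f c v :
  (forall j, (0 < j)%N -> exists s, (0 < s <= j)%N /\ eqv 'C(j, s)%:R 0) ->
  f = c.[Q] -> (forall i, small Q (c`_i)%R) ->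
  (forall i, ge v (c`_i * Q ^+ i)) -> (exists i, eqv (c`_i * Q ^+ i) v) ->
  gt v f -> (forall n w, (0 < n)%N -> ge w f^`N(n) -> lex w 0 f^`N(n)) ->
  exists n w, [/\ (0 < n)%N, eqv f^`N(n) w & qle w (v - eps *+ n)].
Proof.
move=> hbin fE hc hv [i hi] hf hlex.
have ex : exists j, `[< (0 < j)%N /\ eqv (c`_j * Q ^+ j) v >].
  (* If only the term of exponent 0 had value [v], it would be [f] minus terms of value above [v],
     against [gt v f]. *)
  have [i0|i0] := posnP i; last by exists i; apply/asboolP.
  apply: contrapT => /forallNP hN.
  have : gt v (c`_0 * Q ^+ 0); last by apply/negP/eqv_ngt; rewrite -i0.
  have hgt j : (0 < j)%N -> gt v (c`_j * Q ^+ j).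
    by move=> j0; case/ge_eqVgt: (hv j) => // e; case: (hN j); apply/asboolP.
  have sc : (0 < size c)%N.
    rewrite lt0n; apply: contraTneq (eqv_neq0 hi) => /eqP.
    by rewrite size_poly_eq0 => /eqP ->; rewrite coef0 mul0r eqxx.
  move: hf; rewrite fE horner_coef; case: (size c) sc => // n _.
  rewrite big_ord_recl /=; set S := \sum_(_ < _) _ => hS.
  rewrite -[c`_0 * _](addrK S); apply: gtD => //; rewrite gtN.
  by apply: gt_sum => k _; apply: hgt.
case: (ex_minnP ex) => j /asboolP[j0 hj] jmin.
have hlt k : (0 < k < j)%N -> gt v (c`_k * Q ^+ k).
  move=> /andP[k0 kj]; case/ge_eqVgt: (hv k) => // e.
  by move: kj; rewrite ltnNge jmin //; apply/asboolP.
have [s [sj hs]] := hbin j j0.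
have n0 : (0 < s * q)%N by rewrite muln_gt0 (ak_q0 key) andbT; case/andP: sj.
have nl := nderivn_nlex hc hv j0 hj hlt sj hs; rewrite -fE in nl.
have [f0|f0] := eqVneq f^`N(s * q) 0.
  by case: nl; rewrite f0; apply: lex_zero key _ _.
have [w hw] := pval_fin nu f0; exists (s * q)%N, w; split=> //.
(* A derivative of larger value would lie in every step at [v - eps *+ (s * q)], since [hlex] turns
   its value into a truncation; [nderivn_nlex] forbids this. *)
apply: contrapT => /negP wB; apply: nl.
have hBw : qlt (v - eps *+ (s * q)) w by [].
exact (lex_lt _ hBw (hlex _ _ n0 (eqv_ge hw))).
Qed.

End LexProducts.

(** * Slopes *)

Section Slopes.
Variables (K : fieldType) (V : ordQspaceType).
Variable nu : valuation {fraction {poly K}} V.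
Implicit Types (f g h : {poly K}) (v w : V).

Local Notation ge := (pval_ge nu).
Local Notation gt := (pval_gt nu).
Local Notation eqv := (pval_eqv nu).

Lemma hasse_slope_eqv f n v w : eqv f v -> eqv f^`N(n) w ->
  hasse_slope nu f n = ((n%:R^-1 : rat) *: (v - w))%:E.
Proof. by rewrite /hasse_slope => -> ->. Qed.

Lemma hasse_slope_0 f n v : eqv f v -> f^`N(n) = 0 -> hasse_slope nu f n = -oo%E.
Proof. by rewrite /hasse_slope => -> ->; rewrite pval0. Qed.

Lemma nderivn_lead f : f \is monic -> f^`N((size f).-1) = 1.
Proof.
move=> fm; apply/polyP => -[|i].
  by rewrite coef_nderivn addn0 binn mulr1n -lead_coefE (monicP fm) coef1.
rewrite coef_nderivn coef1 nth_default ?mul0rn //.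
by rewrite -[X in (X <= _)%N]prednK ?size_poly_gt0 ?monic_neq0 // addnS ltnS leq_addr.
Qed.

(** Passes from slopes in [\bar V] to inequalities between values, by multiplying through by the
    order of the derivative. *)
Lemma smallest_maximizer_slope f b v : f \is monic -> (1 < size f)%N ->
  smallest_maximizer nu f b -> eqv f v ->
  exists eps : V, [/\ forall n, ge (v - eps *+ n) f^`N(n),
    (0 < b)%N, eqv f^`N(b) (v - eps *+ b),
    forall n, (0 < n < b)%N -> gt (v - eps *+ n) f^`N(n)
    & forall n, I_max nu f b n -> (0 < n)%N /\ eqv f^`N(n) (v - eps *+ n)].
Proof.
move=> fm f1 [[b0 hmax] hmin] hv.
have [w hw] : exists w, eqv f^`N(b) w.
  apply: pval_fin; apply/eqP => fb0.
  (* The derivative of order [deg f] is 1 because [f] is monic, so the maximal slope is not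
     [-oo]. *)
  have N0 : (0 < (size f).-1)%N by case: (size f) f1 => [|[]].
  have e1 : eqv f^`N((size f).-1) 0 by rewrite nderivn_lead //; exact: pval1.
  by have := hmax _ N0; rewrite (hasse_slope_eqv hv e1) (hasse_slope_0 hv fb0).
pose eps := (b%:R^-1 : rat) *: (v - w).
have slopeb : hasse_slope nu f b = eps%:E by exact: hasse_slope_eqv.
have slopen n u : (0 < n)%N -> eqv f^`N(n) u ->
    hasse_slope nu f n = eps%:E -> u = v - eps *+ n.
  move=> n0 hu; rewrite (hasse_slope_eqv hv hu) => -[<-].
  by rewrite invn_scaleMn // opprB addrC subrK.
have wE : w = v - eps *+ b by exact: slopen.
have hge n : ge (v - eps *+ n) f^`N(n).
  have [->|n0] := posnP n; first by rewrite mulr0n subr0 nderivn0; exact: eqv_ge.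
  have [->|fn0] := eqVneq f^`N(n) 0; first exact: ge0.
  have [u hu] := pval_fin nu fn0; rewrite (eqv_geE _ hu).
  have := hmax n n0; rewrite slopeb (hasse_slope_eqv hv hu) /= -(qle_pMn _ _ n0).
  rewrite invn_scaleMn // -(qleD2r (u - eps *+ n)).
  by rewrite addrA subrK [eps *+ n + _]addrC subrK.
exists eps; split=> // [|n /andP[n0 nb]|n [n0 hn]]; first by rewrite -wE.
- case/ge_eqVgt: (hge n) => // e.
  suff : maximizes_slope nu f n by move=> /hmin; rewrite leqNgt nb.
  have en : hasse_slope nu f n = eps%:E.
    rewrite (hasse_slope_eqv hv e); congr (_%:E).
    rewrite opprB addrC subrK -scaler_nat scalerA mulVf ?scale1r //.
    by rewrite Num.Theory.pnatr_eq0 -lt0n.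
  by split=> // k k0; rewrite en -slopeb; exact: hmax.
- split=> //; rewrite slopeb in hn.
  have [fn0|fn0] := eqVneq f^`N(n) 0; first by rewrite (hasse_slope_0 hv fn0) in hn.
  have [u hu] := pval_fin nu fn0.
  by rewrite -(slopen n u n0 hu hn).
Qed.

Lemma eqv_unit_bin p j : char_exponent (residue_field nu) p -> (0 < j)%N ->
  exists e, (p ^ e <= j)%N /\ eqv 'C(j, p ^ e)%:R 0.
Proof.
move=> hp j0; have [e [h1 h2]] := val_unit_bin hp j0; exists e; split=> //.
by rewrite /eqv /pval /pfrac rmorph_nat.
Qed.

Lemma char_exponent_gt0 p : char_exponent (residue_field nu) p -> (0 < p)%N.
Proof. by case=> [/andP[/prime_gt0]|[_ ->]]. Qed.

(* Write [n = m + p ^ e] with [p ^ e] as above, so that ['C(n, p ^ e)] is a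
   unit; if [m > 0] then [Q^`N(m)] has degree smaller than [Q] and its
   [p ^ e]-th derivative is a unit multiple of [Q^`N(n)]. *)
Lemma maximizer_expn (Q : {poly K}) beta eps q p n :
  abstract_key nu Q beta eps q -> char_exponent (residue_field nu) p ->
  (0 < n)%N -> eqv Q^`N(n) (beta - eps *+ n) -> exists e, n = (p ^ e)%N.
Proof.
move=> key hp n0 hn; have [e [en he]] := eqv_unit_bin hp n0.
have pe0 : (0 < p ^ e)%N by rewrite expn_gt0 char_exponent_gt0.
move: en; rewrite leq_eqVlt => /orP[/eqP <-|en]; first by exists e.
have m0 : (0 < n - p ^ e)%N by rewrite subn_gt0.
have := ak_small key (small_nderivn_key key m0) pe0 (ak_ge key (n - p ^ e)%N).
have -> : Q^`N(n - p ^ e)^`N(p ^ e) = 'C(n, p ^ e)%:R * Q^`N(n).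
  by rewrite nderivn_comp subnK ?(ltnW en) // mulr_natl.
rewrite (eqv_gtE _ (eqvM he hn)) add0r -addrA -opprD -mulrnDr subnK ?(ltnW en) //.
by rewrite /qlt qle_refl.
Qed.

(** By [slope_increase] some derivative of order [n] has value at most [v - eps *+ n]. As [f] itself
    has value [beta' > v], the corresponding slope exceeds [eps], while [eps'] bounds all slopes. *)
Lemma key_slope_lt (Q : {poly K}) beta eps q p f v beta' eps' c :
  abstract_key nu Q beta eps q -> char_exponent (residue_field nu) p ->
  f = c.[Q] -> (forall i, (size (c`_i)%R < size Q)%N) ->
  (forall i, ge v (c`_i * Q ^+ i)) -> (exists i, eqv (c`_i * Q ^+ i) v) ->
  (forall n w, (0 < n)%N -> ge w f^`N(n) -> lex nu Q w 0 f^`N(n)) ->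
  eqv f beta' -> qlt v beta' -> (forall n, ge (beta' - eps' *+ n) f^`N(n)) ->
  qlt eps eps'.
Proof.
move=> key hp fE hc hv hi hlex hf vb hge.
have hbin j : (0 < j)%N -> exists s, (0 < s <= j)%N /\ eqv 'C(j, s)%:R 0.
  move=> j0; have [e [h1 h2]] := eqv_unit_bin hp j0; exists (p ^ e)%N.
  by rewrite h1 expn_gt0 char_exponent_gt0.
have gf : gt v f by rewrite (eqv_gtE _ hf).
have [n [w [n0 hw wn]]] := slope_increase key hbin fE hc hv hi gf hlex.
have := hge n; rewrite (eqv_geE _ hw) => h1.
have : qlt (beta' - eps' *+ n) (beta' - eps *+ n).
  apply: (@qle_lt_trans _ _ (v - eps *+ n)); last by rewrite qltD2r.
  exact: qle_trans h1 wn.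
by rewrite ![beta' + _]addrC qltD2r /qlt qleN2 qle_pMn.
Qed.

End Slopes.

(** * Well-ordered indices and standard exponents *)

Section Indices.
Context {d : Order.disp_t} {Lam : bOrderType d}.
Variable alpha : Lam -> nat.
Implicit Types (i j k l m : Lam).
Local Open Scope order_scope.

Local Notation below l := ([set q : Lam | q <= l]).

Lemma is_succ_fun i j j' : is_succ i j -> is_succ i j' -> j = j'.
Proof. by move=> [ij hi] [i'j hi']; apply/eqP; rewrite eq_le hi // hi'. Qed.

Lemma is_succ_le i j k : is_succ i j -> k < j -> k <= i.
Proof. by move=> [ij hi] kj; rewrite leNgt; apply/negP => /hi; rewrite leNgt kj. Qed.

Lemma is_shift_le i t j : is_shift i t j -> i <= j.
Proof.
elim: t j => [|t IHt] j /=; first by move=> ->.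
by move=> [k /IHt ik [kj _]]; apply: le_trans ik (ltW kj).
Qed.

Lemma is_shift_fun i t j j' : is_shift i t j -> is_shift i t j' -> j = j'.
Proof.
elim: t j j' => [|t IHt] j j' /=; first by move=> -> ->.
move=> [k /IHt h kj] [k' /h kk' k'j']; subst k'; exact: is_succ_fun kj k'j'.
Qed.

Lemma is_shift_add i s t j k :
  is_shift i s j -> is_shift j t k -> is_shift i (s + t) k.
Proof.
move=> ij; elim: t k => [|t IHt] k /=; first by move=> ->; rewrite addn0.
by rewrite addnS /= => -[k' /IHt h k'k]; exists k'.
Qed.

Lemma above_shifts_lt i k : above_shifts i k -> i < k.
Proof. by move=> h; have [j /= -> //] := h 0%N. Qed.

Lemma omega_lt i k : is_shift_omega i k -> i < k.
Proof. by move=> [h _]; exact: above_shifts_lt. Qed.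

Lemma omega_fun i k k' : is_shift_omega i k -> is_shift_omega i k' -> k = k'.
Proof. by move=> [h1 h2] [h3 h4]; apply/eqP; rewrite eq_le h2 // h4. Qed.

Lemma is_shift_between i k m : above_shifts i k ->
  i <= m -> (exists t j, is_shift i t j /\ m <= j) -> exists t, is_shift i t m.
Proof.
move=> hk im [t]; elim: t => [|t IHt] [j /= [ij mj]].
  by exists 0%N; apply/eqP; rewrite eq_le im -ij mj.
have [j' ij' j'j] := ij.
case: (leP m j') => h; first by apply: IHt; exists j'.
exists t.+1; have <- : j = m by apply/eqP; rewrite eq_le mj j'j.2.
exact: ij.
Qed.

(** Otherwise [m] would bound all finite shifts of [i], against the minimality of [i + omega]. *)
Lemma omega_between i k m : is_shift_omega i k -> i <= m -> m < k ->
  exists t, is_shift i t m.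
Proof.
move=> [hk hmin] im mk; apply: (is_shift_between hk) => //.
apply: contrapT => hN; have am : above_shifts i m.
  move=> t; have [j ij jk] := hk t; exists j => //.
  by rewrite ltNge; apply/negP => mj; apply: hN; exists t, j.
by have := hmin m am; rewrite leNgt mk.
Qed.

Lemma omega_shift i k t m : is_shift_omega i k -> is_shift i t m ->
  is_shift_omega m k.
Proof.
move=> [hk hmin] im; split=> [s|k' hk'].
  have [j ij jk] := hk (t + s)%N; exists j => //.
  elim: s j ij {jk} => [|s IHs] j.
    by rewrite addn0 /= => ij; exact: is_shift_fun ij im.
  by rewrite addnS /= => -[j' /IHs h j'j]; exists j'.
apply: hmin => s; case: (leqP t s) => ts.
  have [j mj jk'] := hk' (s - t)%N; exists j => //.
  by rewrite -(subnKC ts); exact: is_shift_add im mj.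
have [j ij _] := hk s; exists j => //; apply: le_lt_trans (above_shifts_lt hk').
have [e te] : exists e, t = (s + e)%N by exists (t - s)%N; rewrite subnKC // ltnW.
move: im; rewrite te; elim: e m {te hk'} => [|e IHe] m.
  by rewrite addn0 => im; rewrite (is_shift_fun ij im).
by rewrite addnS /= => -[m' /IHe jm' [m'm _]]; apply: le_trans jm' (ltW m'm).
Qed.

Lemma omega_between_omega i k m : is_shift_omega i k -> i <= m -> m < k ->
  is_shift_omega m k.
Proof.
by move=> hk im mk; have [t it] := omega_between hk im mk; exact: omega_shift it.
Qed.

(** A predecessor would be some [i + t], and [i + (t + 1)] is still below [i + omega]. *)
Lemma omega_not_succ i k m : is_shift_omega i k -> ~ is_succ m k.
Proof.
move=> hk mk; have im : i <= m by exact: is_succ_le mk (omega_lt hk).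
have [t it] := omega_between hk im mk.1.
have [j [j' ij' j'j] jk] := hk.1 t.+1.
have := is_shift_fun it ij' => E; subst j'.
by have := is_succ_fun mk j'j => E; move: jk; rewrite E ltxx.
Qed.

Lemma inessential_shift (D : set Lam) i t m : inessential alpha D i ->
  is_shift i t m -> inessential alpha D m.
Proof.
move=> [[k Dk ik] h] im; split; first by exists k => //; exact: omega_shift im.
by move=> s j mj; apply: (h (t + s)%N); exact: is_shift_add im mj.
Qed.

Lemma is_plus_fun (D : set Lam) i k k' :
  is_plus alpha D i k -> is_plus alpha D i k' -> k = k'.
Proof.
move=> [_ [[h1 h2]|[h1 h2]]] [_ [[h3 h4]|[h3 h4]]] //.
- exact: omega_fun h2 h4.
- exact: is_succ_fun h2 h4.
Qed.

Lemma is_plus_lt (D : set Lam) i k : is_plus alpha D i k -> i < k.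
Proof. by move=> [_ [[_ /omega_lt]|[_ []]]]. Qed.

Lemma inessential_below l m i : l <= m ->
  inessential alpha (below l) i -> inessential alpha (below m) i.
Proof. by move=> lm [[k /= kl ik] h]; split=> //; exists k => //=; exact: le_trans lm. Qed.

(* The indices of [s, l) are the predecessor of [l], or, when [l] is a limit,
   all the indices [j] with [j+ = l]. *)
Record block (s l : Lam) : Prop := Block {
  block_lt : s < l;
  block_plus : forall j, s <= j -> j < l -> is_plus alpha (below l) j l;
  block_iness : forall i, i < s -> inessential alpha (below l) i ->
    inessential alpha (below s) i;
  block_unique : forall j j', s <= j -> j < l -> s <= j' -> j' < l ->
    j = j' \/ inessential alpha (below l) j
}.

(** A successor [l] is not of the form [i + omega]. Hence [s] is not inessential below [l], and an
    inessential index has its limit already below or at [s]. *)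
Lemma block_succ s l : is_succ s l -> block s l.
Proof.
move=> sl; have nom j : ~ is_shift_omega j l by move=> h; exact: omega_not_succ h sl.
have js j : s <= j -> j < l -> j = s.
  by move=> sj jl; apply/eqP; rewrite eq_le sj (is_succ_le sl).
split; first exact: sl.1.
- move=> j sj jl; rewrite (js j) //; split; first exact: lexx.
  right; split=> // -[[k /= kl sk] _].
  have := omega_lt sk => /sl.2 lk; have E : k = l by apply/eqP; rewrite eq_le kl lk.
  by apply: (nom s); rewrite -E.
- move=> i lis [[k /= kl ik] h]; split=> //; exists k => //=.
  apply: (is_succ_le sl); rewrite lt_neqAle kl andbT; apply/eqP => E.
  by apply: (nom i); rewrite -E.
- by move=> j j' h1 h2 h3 h4; left; rewrite (js j) // (js j').
Qed.

(** Take for [s'] the least index with [s'+ = l]. Every index from [s'] up to [l] is a finite shift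
    of [s'], so it is inessential with the same limit. *)
Lemma block_limit s l : well_founded (fun i j : Lam => i < j) ->
  is_plus alpha setT s l -> ~ (exists i, is_succ i l) ->
  exists s', block s' l /\
    (forall j, is_plus alpha setT j l <-> s' <= j /\ j < l).
Proof.
move=> wf hs nsucc.
have [s' hs' smin] : exists2 s', is_plus alpha setT s' l &
    forall j, is_plus alpha setT j l -> s' <= j.
  elim/(well_founded_ind wf): s hs => s IHs hs.
  have [[j [jl js]]|hN] := pselect (exists j, is_plus alpha setT j l /\ j < s).
    exact: IHs js jl.
  exists s => // j jl; rewrite leNgt; apply/negP => js; apply: hN; by exists j.
have iness j : is_plus alpha setT j l ->
    inessential alpha (below l) j /\ is_shift_omega j l.
  move=> [_ [[[_ h2] h3]|[_ h2]]]; last by case: nsucc; exists j.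
  by split=> //; split=> //; exists l => //=.
have [is' os'] := iness _ hs'.
have hj j : s' <= j -> j < l -> inessential alpha (below l) j /\ is_shift_omega j l.
  move=> sj jl; have [t st] := omega_between os' sj jl.
  by split; [exact: inessential_shift st | exact: omega_shift st].
have setTP j : inessential alpha (below l) j -> is_shift_omega j l ->
    is_plus alpha setT j l.
  by move=> [[k _ jk] h] jl; split=> //; left; split=> //; split=> //; exists k.
exists s'; split; last first.
  move=> j; split=> [jl|[sj jl]]; first by split; [exact: smin | exact: is_plus_lt jl].
  by have [h1 h2] := hj j sj jl; exact: setTP.
split; first exact: is_plus_lt hs'.
- by move=> j sj jl; have [h1 h2] := hj j sj jl; split; [exact: lexx | left].
(* If the limit [k] of [i] were beyond [s'], it would equal [l], so that [i+ = l] with [i < s'],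
   against the choice of [s']. *)
- move=> i is'' hi; have [[k /= kl ik] h] := hi; split=> //; exists k => //=.
  rewrite leNgt; apply/negP => sk; have ok := omega_between_omega ik (ltW is'') sk.
  have E := omega_fun ok os'; subst k.
  by have := smin _ (setTP _ hi ik); rewrite leNgt is''.
- by move=> j j' sj jl _ _; right; case: (hj j sj jl).
Qed.

(** * Transfer of standard exponents across a block *)

Section BlockTransfer.
Variables (s l : Lam).
Hypothesis B : block s l.

Lemma block_iness_iff i : i < s ->
  inessential alpha (below l) i <-> inessential alpha (below s) i.
Proof.
move=> lis; split; first exact: (block_iness B).
exact/inessential_below/ltW/(block_lt B).
Qed.

Lemma block_plus_iff i k : i < s ->
  is_plus alpha (below l) i k <-> is_plus alpha (below s) i k.
Proof.
move=> lis; have E := block_iness_iff lis; split.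
  move=> [/= kl [[h1 h2]|[h1 h2]]].
    have h3 := proj1 E h1; split; last by left.
    by have [[k' /= k's ik'] _] := h3; rewrite (omega_fun h2 ik').
  split; last by right; split=> // /(proj2 E).
  by apply: h2.2.
move=> [/= ks [[h1 h2]|[h1 h2]]]; split=> /=; try exact: le_trans ks (ltW (block_lt B)).
  by left; split=> //; apply/(proj2 E).
by right; split=> // /(proj1 E).
Qed.

Lemma block_plusE i k : is_plus alpha (below l) i k -> k != l -> i < s /\ k <= s.
Proof.
move=> ik kl; have il : i < l by exact: lt_le_trans (is_plus_lt ik) ik.1.
have lis : i < s.
  rewrite ltNge; apply/negP => si; case/eqP: kl.
  exact: is_plus_fun ik (block_plus B si il).
by split=> //; have [] := proj1 (block_plus_iff k lis) ik.
Qed.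

Lemma block_plus_l i : is_plus alpha (below l) i l <-> s <= i /\ i < l.
Proof.
split=> [h|[h1 h2]]; last exact: (block_plus B).
split; last exact: is_plus_lt h.
rewrite leNgt; apply/negP => lis; have [/= ls _] := proj1 (block_plus_iff l lis) h.
by have := block_lt B; rewrite ltNge ls.
Qed.

(* Standard exponents at [l] are obtained from free ones at [s] by adding the
   exponent of a single index of the block. *)
Lemma free_exponent_extend (g g' : {fsfun Lam -> nat with 0%N}) j :
  s <= j -> j < l -> free_exponent alpha s g -> (g' j < alpha l)%N ->
  (forall i, i != j -> g' i = g i) -> free_exponent alpha l g'.
Proof.
move=> sj jl [[hs hb hu] g0] gj hg; have sl := block_lt B.
have glt i : g i <> 0%N -> i < s.
  move=> gi; rewrite lt_neqAle hs // andbT; apply/eqP => E.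
  by apply: gi; rewrite E.
have gs i : s <= i -> i != j -> g' i = 0%N.
  move=> si ij; rewrite hg //; apply: contrapT => /glt.
  by rewrite ltNge si.
split; last by apply: gs; [exact: ltW | rewrite gt_eqF].
have jE i : s <= i -> g' i <> 0%N -> i = j.
  by move=> si gi; apply/eqP; apply: contrapT => /negP /(gs _ si).
have ltj i : i < s -> g' i = g i.
  by move=> lis; apply: hg; rewrite lt_eqF // (lt_le_trans lis).
split=> [i gi|i k il ik|i k j1 j2 hi ik j1k j2k g1 g2].
- have [->|ij] := eqVneq i j; first exact: ltW.
  by rewrite hg // in gi; apply: le_trans (ltW sl); apply: hs.
- have [E|kl] := eqVneq k l.
    subst k; have [si _] := proj1 (block_plus_l i) ik.
    by have [->|ij] := eqVneq i j; rewrite // gs // (leq_ltn_trans _ gj).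
  have [lis ks] := block_plusE ik kl; rewrite ltj //.
  exact/hb/(proj1 (block_plus_iff k lis)).
- have [E|kl] := eqVneq k l.
    subst k; have [s1 _] := proj1 (block_plus_l j1) j1k.
    have [s2 _] := proj1 (block_plus_l j2) j2k.
    exact: etrans (jE _ s1 g1) (esym (jE _ s2 g2)).
  have [lis ks] := block_plusE ik kl.
  have [l1 _] := block_plusE j1k kl; have [l2 _] := block_plusE j2k kl.
  rewrite !ltj // in g1 g2.
  apply: (hu i k) => //; first exact/(proj1 (block_iness_iff lis)).
  + exact/(proj1 (block_plus_iff k lis)).
  + exact/(proj1 (block_plus_iff k l1)).
  + exact/(proj1 (block_plus_iff k l2)).
Qed.

(** Converse of the extension: by [block_unique] and the uniqueness clause for inessential indices,
    at most one index of the block has a nonzero exponent. If there is none, [s] serves. *)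
Lemma free_exponent_restrict (g : {fsfun Lam -> nat with 0%N}) :
  free_exponent alpha l g ->
  exists j, [/\ s <= j, j < l, (g j < alpha l)%N &
    forall g' : {fsfun Lam -> nat with 0%N}, g' j = 0%N ->
      (forall i, i != j -> g' i = g i) -> free_exponent alpha s g'].
Proof.
move=> [[hs hb hu] gl]; have sl := block_lt B.
have [j [sj jl gs]] : exists j, [/\ s <= j, j < l &
    forall i, s <= i -> i != j -> g i = 0%N].
  have glt i : g i <> 0%N -> i < l.
    move=> gi; rewrite lt_neqAle hs // andbT; apply/eqP => E.
    by apply: gi; rewrite E.
  have [[j [sj jl gj]]|hN] := pselect (exists j, [/\ s <= j, j < l & g j <> 0%N]).
    exists j; split=> // i si ij; apply: contrapT => gi.
    have il := glt _ gi; case/eqP: ij.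
    have [//|hi] := block_unique B si il sj jl.
    by apply: (hu i l i j) => //; exact: (block_plus B).
  exists s; split=> // i si _; apply: contrapT => gi; apply: hN; exists i.
  by split=> //; exact: glt.
exists j; split=> //; first exact: hb jl (block_plus B sj jl).
move=> g' g'j hg.
have g's i : s <= i -> g' i = 0%N.
  by move=> si; have [->//|ij] := eqVneq i j; rewrite hg // gs.
have ltj i : i < s -> g' i = g i.
  by move=> lis; apply: hg; rewrite lt_eqF // (lt_le_trans lis).
split; last exact: g's.
split=> [i gi|i k lis ik|i k j1 j2 hi ik j1k j2k g1 g2].
- rewrite leNgt; apply/negP => /ltW si; apply: gi; exact: g's.
- by rewrite ltj //; apply: hb; [exact: lt_trans sl | exact/(proj2 (block_plus_iff k lis))].
- have ls i' : is_plus alpha (below s) i' k -> i' < s.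
    by move=> h; exact: lt_le_trans (is_plus_lt h) h.1.
  have lis := ls _ ik; have l1 := ls _ j1k; have l2 := ls _ j2k.
  rewrite !ltj // in g1 g2.
  apply: (hu i k) => //; first exact/(proj2 (block_iness_iff lis)).
  + exact/(proj2 (block_plus_iff k lis)).
  + exact/(proj2 (block_plus_iff k l1)).
  + exact/(proj2 (block_plus_iff k l2)).
Qed.

End BlockTransfer.
End Indices.

(** * Initial forms *)

Section GradedClass.
Local Open Scope quotient_scope.
Variables (F : fieldType) (V : ordQspaceType) (nu : valuation F V).
Implicit Types (y z : F) (b : V).

Lemma gr_classE b y (h : vle (b, y).1%:E (nu (b, y).2)) :
  gr_class nu b y = \pi_(gr nu) [:: exist _ (b, y) h].
Proof.
rewrite /gr_class; case: insubP => [u _ E|]; last by rewrite h.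
by congr (\pi_(gr nu) [:: _]); apply: val_inj.
Qed.

Lemma gr_coef1 (p : gr_piece nu) b :
  gr_coef [:: p] b = if (val p).1 == b then (val p).2 else 0.
Proof. by rewrite /gr_coef big_mkcond big_seq1. Qed.

Lemma gr_classD b y z : vle b%:E (nu y) -> vle b%:E (nu z) ->
  gr_class nu b (y + z) = gr_class nu b y + gr_class nu b z.
Proof.
move=> hy hz; have hyz := val_leD hy hz.
rewrite (@gr_classE b y hy) (@gr_classE b z hz) (@gr_classE b (y + z) hyz).
rewrite -[(\pi_(gr nu) _ + _)%R]/(gr_add _ _) !piE.
apply/pi_coef_eq => e; rewrite coef_add !gr_coef1 /=.
by case: eqP => //; rewrite addr0.
Qed.

Lemma gr_classM b e y z : vle b%:E (nu y) -> vle e%:E (nu z) ->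
  gr_class nu b y * gr_class nu e z = gr_class nu (b + e) (y * z).
Proof.
move=> hy hz; have hyz := val_leM hy hz.
rewrite (@gr_classE b y hy) (@gr_classE e z hz) (@gr_classE (b + e) (y * z) hyz).
rewrite -[(\pi_(gr nu) _ * _)%R]/(gr_mul _ _) !piE.
apply/pi_coef_eq => k; rewrite coef_mul big_seq1 !gr_coef1 /=.
by rewrite eq_sym subr_eq addrC eq_sym; case: eqP => //; rewrite mulr0.
Qed.

Lemma gr_class_eq0 b y : vle b%:E (nu y) ->
  gr_class nu b y = 0 <-> vlt b%:E (nu y).
Proof.
move=> hy; rewrite (@gr_classE b y hy) -[0]/(gr_zero nu) piE; split.
  by move=> /eqmodP /asboolP /(_ b); rewrite gr_coef1 coef_nil /= eqxx subr0.
move=> h; apply/eqmodP/asboolP => e; rewrite gr_coef1 coef_nil subr0 /=.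
by case: eqP => [<-//|_]; rewrite val0.
Qed.

End GradedClass.

Section GradedPolynomials.
Local Open Scope quotient_scope.
Variables (K : fieldType) (V : ordQspaceType).
Variable nu : valuation {fraction {poly K}} V.
Implicit Types (f g h : {poly K}) (v w : V).

Local Notation ge := (pval_ge nu).
Local Notation gt := (pval_gt nu).
Local Notation eqv := (pval_eqv nu).
Local Notation cls v f := (gr_class nu v (pfrac f)).
Local Notation inp f := (gr_in nu (pfrac f)).

Lemma gr_in_eqv f v : eqv f v -> inp f = cls v f.
Proof. by rewrite /eqv /pval /gr_in => ->. Qed.

Lemma cls_eq0 f v : ge v f -> cls v f = 0 <-> gt v f.
Proof. exact: gr_class_eq0. Qed.

Lemma clsD f g v : ge v f -> ge v g -> cls v (f + g) = cls v f + cls v g.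
Proof. by move=> hf hg; rewrite /pfrac rmorphD; exact: gr_classD. Qed.

Lemma cls_sum (I : Type) (r : seq I) (P : pred I) (f : I -> {poly K}) v :
  (forall i, P i -> ge v (f i)) ->
  cls v (\sum_(i <- r | P i) f i) = \sum_(i <- r | P i) cls v (f i).
Proof.
move=> h; elim: r => [|i r IHr].
  by rewrite !big_nil; apply/cls_eq0; [exact: ge0 | exact: gt0].
rewrite !big_cons; case: ifP => // Pi; rewrite clsD ?IHr ?h //.
by apply: ge_sum => j Pj; exact: h.
Qed.

Lemma gr_inM f g : f != 0 -> g != 0 -> inp (f * g) = inp f * inp g.
Proof.
move=> /(pval_fin nu)[v hf] /(pval_fin nu)[w hg].
rewrite (gr_in_eqv (eqvM hf hg)) (gr_in_eqv hf) (gr_in_eqv hg).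
rewrite gr_classM; [| exact: eqv_ge hf | exact: eqv_ge hg].
by rewrite /pfrac rmorphM.
Qed.

Lemma gr_in1 : inp 1 = 1.
Proof.
rewrite (gr_in_eqv (pval1 nu)) /pfrac rmorph1.
rewrite (@gr_classE _ _ nu 0 1 (piece_oneP nu)) -[RHS]/(gr_one nu).
have -> : gr_one nu = \pi_(gr nu) (rep_one nu) by rewrite piE.
by congr (\pi_(gr nu) [:: _]); apply: val_inj.
Qed.

Lemma gr_inX f n : f != 0 -> inp (f ^+ n) = inp f ^+ n.
Proof.
move=> f0; elim: n => [|n IHn]; first by rewrite !expr0 gr_in1.
by rewrite !exprS gr_inM ?IHn // expf_neq0.
Qed.

Lemma gr_in_neq0 f v : eqv f v -> inp f != 0.
Proof.
move=> hf; rewrite (gr_in_eqv hf); apply/eqP => /(cls_eq0 (eqv_ge hf)).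
exact/negP/eqv_ngt.
Qed.

Lemma cls_cases f v : ge v f -> (eqv f v /\ cls v f = inp f) \/ cls v f = 0.
Proof.
move=> h; case/ge_eqVgt: (h) => e; first by left; rewrite (gr_in_eqv e).
by right; apply/cls_eq0.
Qed.

(* A strict inequality would give an algebraic relation of degree less than
   that of [P]. *)
Lemma minimal_relation_ngt (A : set (gr nu)) (Q : {poly K}) beta P v
    (c : {poly {poly K}}) : A 0 -> eqv Q beta ->
  minimal_relation A (inp Q) P -> (size c < size P)%N ->
  (forall i, c`_i != 0 -> A (inp (c`_i))) ->
  (forall i, ge v (c`_i * Q ^+ i)) -> (exists i, eqv (c`_i * Q ^+ i) v) ->
  ~ gt v c.[Q].
Proof.
move=> A0 hQ [_ _ _ hmin] sc hA hge [i0 hi0] hgt.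
(* Initial forms of the coefficients of the terms of minimal value [v]; the remaining terms vanish
   in degree [v]. *)
pose E i := if `[< eqv (c`_i * Q ^+ i) v >] then inp (c`_i) else 0.
have Q0 := eqv_neq0 hQ.
have cQ i : eqv (c`_i * Q ^+ i) v -> c`_i != 0.
  by move=> /eqv_neq0; rewrite mulf_eq0 negb_or => /andP[].
pose P' := \poly_(i < size c) E i.
have i0c : (i0 < size c)%N.
  by apply: contraNltn (cQ _ hi0) => h; rewrite nth_default.
have E0 : E i0 != 0.
  rewrite /E asboolT //; have [u hu] := pval_fin nu (cQ _ hi0).
  exact: gr_in_neq0 hu.
suff : (size P <= size P')%N.
  by rewrite leqNgt (leq_ltn_trans (size_poly _ _) sc).
apply: hmin.
- have : P'`_i0 != 0 by rewrite coef_poly i0c.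
  by apply: contraNneq => ->; rewrite coef0.
- move=> i; rewrite coef_poly /E; case: ifP => // _; case: asboolP => // h.
  exact/hA/cQ.
rewrite /root horner_poly; apply/eqP.
(* Evaluated at the initial form of [Q], the new relation is the class of [c.[Q]] in degree [v],
   which is zero by [hgt]. *)
transitivity (cls v c.[Q]); last exact/cls_eq0/hgt/gt_ge.
rewrite horner_coef cls_sum //; apply: eq_bigr => i _; rewrite /E.
case: asboolP => h.
  by rewrite -(gr_in_eqv h) gr_inM ?cQ ?expf_neq0 // gr_inX.
rewrite mul0r; apply/esym/cls_eq0 => //; case/ge_eqVgt: (hge i) => //.
Qed.

Section Subring.
Variable A : set (gr nu).
Hypothesis sA : gr_subring A.

Lemma gr_subring0 : A 0.
Proof. by case: sA => h1 hB _; rewrite -(subrr 1); exact: hB. Qed.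

Lemma gr_subringD x y : A x -> A y -> A (x + y).
Proof.
case: sA => _ hB _ hx hy; rewrite -[y]opprK; apply: (hB) => //.
by rewrite -sub0r; apply: hB => //; exact: gr_subring0.
Qed.

Lemma gr_subring_sum (I : eqType) (r : seq I) (f : I -> gr nu) :
  (forall i, i \in r -> A (f i)) -> A (\sum_(i <- r) f i).
Proof.
elim: r => [|i r IHr] h; first by rewrite big_nil; exact: gr_subring0.
rewrite big_cons; apply: gr_subringD; first by apply: h; rewrite mem_head.
by apply: IHr => j jr; apply: h; rewrite inE jr orbT.
Qed.

End Subring.

Section Expansions.
Context {d : Order.disp_t} {Lam : bOrderType d}.
Variables (alpha : Lam -> nat) (Q : Lam -> {poly K}).
Hypothesis Qmon : forall i, Q i \is monic.
Implicit Types (i l : Lam) (m : K * {fsfun Lam -> nat with 0%N}).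

Lemma expo_prod_neq0 (e : {fsfun Lam -> nat with 0%N}) : expo_prod Q e != 0.
Proof. by apply/monic_neq0/monic_prod => i _; exact: monic_exp. Qed.

Lemma monomialE m : monomial Q m = m.1%:P * expo_prod Q m.2.
Proof. by rewrite mul_polyC. Qed.

Lemma vle_bigmin (I : eqType) (r : seq I) (G : I -> \bar V) (i : I) :
  i \in r -> vle (\big[@vmin V/+oo%E]_(j <- r) G j) (G i).
Proof.
elim: r => // j r IHr; rewrite big_cons inE /vmin.
have [/eqP ->|ij] := boolP (i == j) => /=.
  move=> _; case: ifP => h; first exact: vle_refl.
  by have := vle_total (G j) (\big[@vmin V/+oo%E]_(k <- r) G k); rewrite h.
move=> ir; case: ifP => h; last exact: IHr.
by apply: vle_trans h _; exact: IHr.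
Qed.

Lemma bigmin_glb (I : eqType) (r : seq I) (G : I -> \bar V) x :
  (forall i : I, i \in r -> vle x (G i)) -> vle x (\big[@vmin V/+oo%E]_(j <- r) G j).
Proof.
elim: r => [|i r IHr] h; first by rewrite big_nil; case: x {h}.
rewrite big_cons /vmin; case: ifP => _; first by apply: h; rewrite mem_head.
by apply: IHr => j jr; apply: h; rewrite inE jr orbT.
Qed.

(** The value of [f] is the minimum over its monomials, so the initial form is the sum of their
    classes in that degree. Each class is zero or a product of initial forms of a constant and of
    keys [Q q]; freeness gives [q < l]. *)
Lemma free_std_poly_gr_in l f : free_std_poly nu alpha Q l f -> f != 0 ->
  forall A, gr_subring A -> (forall x : K, A (inp x%:P)) ->
  (forall q, (q < l)%O -> A (inp (Q q))) -> A (inp f).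
Proof.
move=> [s [hfree hval] fE] /(pval_fin nu)[v hv] A sA hK hQ.
have hm m : m \in s -> ge v (monomial Q m).
  by move=> ms; rewrite /pval_ge -hv fE hval; exact: vle_bigmin.
rewrite (gr_in_eqv hv) fE big_seq cls_sum // -big_seq.
apply: gr_subring_sum => // m ms.
have [[e ->]|->] := cls_cases (hm _ ms); last exact: gr_subring0.
have m0 : m.1%:P != 0 :> {poly K}.
  by apply: contraTneq (eqv_neq0 e) => h; rewrite monomialE h mul0r eqxx.
rewrite monomialE gr_inM ?expo_prod_neq0 //.
case: (sA) => h1 _ hM; apply: (hM) => //; rewrite /expo_prod.
have [[hs _ _] g0] := hfree m ms.
have hq q : q \in enum_fset (finsupp m.2) -> A (inp (Q q)).
  rewrite -[_ \in _]/(q \in finsupp m.2) mem_finsupp => /eqP gq.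
  apply: hQ; rewrite lt_neqAle hs // andbT.
  by apply/eqP => E; apply: gq; rewrite E.
elim: (enum_fset (finsupp m.2)) hq => [|q r IHr] hq; first by rewrite big_nil gr_in1.
have Qn i : Q i != 0 by exact: monic_neq0.
rewrite big_cons gr_inM ?expf_neq0 //; last first.
  by apply/monic_neq0/monic_prod => i _; exact: monic_exp.
apply: (hM); last by apply: IHr => i ir; apply: hq; rewrite inE ir orbT.
rewrite gr_inX //; have := hq q (mem_head _ _).
by move=> hAq; elim: (m.2 q) => [|n IHn]; rewrite ?expr0 // exprS; exact: hM.
Qed.

End Expansions.
End GradedPolynomials.

(** * Expansions and monomials *)

Section Minima.
Variables (K : fieldType) (V : ordQspaceType).
Variable nu : valuation {fraction {poly K}} V.
Implicit Types (f g h : {poly K}) (v w : V) (c : {poly {poly K}}).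

Local Notation ge := (pval_ge nu).
Local Notation gt := (pval_gt nu).
Local Notation eqv := (pval_eqv nu).
Local Notation small Q f := (size (f : {poly K}) < size (Q : {poly K}))%N.

(** The search starts from the leading term, which is nonzero, so the minimum is finite. *)
Lemma expansion_min_value (Q : {poly K}) c : Q != 0 -> c != 0 ->
  exists v, (forall k, ge v (c`_k * Q ^+ k)) /\ exists k, eqv (c`_k * Q ^+ k) v.
Proof.
move=> Q0 c0; set f := fun k => c`_k * Q ^+ k.
have f0 : f (size c).-1 != 0 by rewrite mulf_neq0 ?expf_neq0 // -lead_coefE lead_coef_eq0.
have key n : exists v, ((forall k, (k < n)%N -> ge v (f k)) /\ ge v (f (size c).-1))
    /\ exists k, eqv (f k) v.
  elim: n => [|n [v [[h1 h2] h3]]].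
    have [v hv] := pval_fin nu f0; exists v; split; last by exists (size c).-1.
    by split=> //; exact: eqv_ge.
  have [hn|hn] := boolP (ge v (f n)).
    exists v; split=> //; split=> // k.
    by rewrite ltnS leq_eqVlt => /orP[/eqP ->|]; [exact: hn | exact: h1].
  have [w hw] : exists w, eqv (f n) w.
    by apply: pval_fin; apply: contraNneq hn => ->; exact: ge0.
  have wv : qle w v.
    by move: hn; rewrite (eqv_geE _ hw) => /qltW.
  exists w; split; last by exists n.
  split; last exact: ge_le h2.
  move=> k; rewrite ltnS leq_eqVlt => /orP[/eqP ->|kn]; first exact: eqv_ge.
  exact: ge_le (h1 k kn).
have [v [[h1 _] h2]] := key (size c); exists v; split=> // k.
have [kc|kc] := ltnP k (size c); first exact: h1.
by rewrite nth_default // mul0r; exact: ge0.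
Qed.

Lemma vle_sum (I : eqType) (r : seq I) (f : I -> {poly K}) x :
  (forall i, i \in r -> vle x (pval nu (f i))) -> vle x (pval nu (\sum_(i <- r) f i)).
Proof.
elim: r => [|i r IHr] h; first by rewrite big_nil pval0; case: x {h}.
rewrite big_cons /pval /pfrac rmorphD; apply: val_leD; first by apply: h; rewrite mem_head.
by apply: IHr => j jr; apply: h; rewrite inE jr orbT.
Qed.

Lemma vle_pvalM f f' g : vle (pval nu f) (pval nu f') ->
  vle (pval nu (f * g)) (pval nu (f' * g)).
Proof.
have [->|g0] := eqVneq g 0; first by rewrite !mulr0 => _; exact: vle_refl.
have [w hw] := pval_fin nu g0; rewrite !pvalM hw.
case: (pval nu f) (@val_neqNy _ _ nu (pfrac f)) => [u||] //= _;
  case: (pval nu f') (@val_neqNy _ _ nu (pfrac f')) => [u'||] //= _.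
by rewrite qleD2r.
Qed.

End Minima.

Section Exponents.
Variables (K : fieldType) (d : Order.disp_t) (Lam : bOrderType d) (Q : Lam -> {poly K}).
Hypothesis Qmon : forall i, Q i \is monic.
Implicit Types (g : {fsfun Lam -> nat with 0%N}).
Local Open Scope fset_scope.

Lemma expo_prodE g (A : {fset Lam}) : (finsupp g `<=` A)%fset ->
  expo_prod Q g = \prod_(i <- A) Q i ^+ g i.
Proof.
move=> gA; rewrite /expo_prod; apply: big_fset_incl => // i _.
by rewrite mem_finsupp negbK => /eqP ->; rewrite expr0.
Qed.

Lemma expo_prod_with g j k : g j = 0%N ->
  expo_prod Q [fsfun g with j |-> k] = expo_prod Q g * Q j ^+ k.
Proof.
move=> gj; pose A := (j |` finsupp g)%fset.
have jA : j \in A by rewrite !inE eqxx.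
rewrite (@expo_prodE g A) ?fsubsetUr // (@expo_prodE _ A); last first.
  apply/fsubsetP => i; rewrite mem_finsupp fsfun_withE in_fset1U mem_finsupp.
  by have [->|] := eqVneq i j; rewrite ?eqxx.
rewrite (big_fsetD1 j) //= [in RHS](big_fsetD1 j) //= gj expr0 mul1r mulrC.
rewrite fsfun_with; congr (_ * _); apply: eq_big_seq => i.
by rewrite !inE fsfun_withE => /andP[/negbTE -> _].
Qed.

End Exponents.

(** * Key polynomials are abstract key polynomials *)

Section SuccessorStep.
Variables (K : fieldType) (V : ordQspaceType).
Variable nu : valuation {fraction {poly K}} V.
Context {d : Order.disp_t} {Lam : bOrderType d}.
Variables (alpha : Lam -> nat) (Q : Lam -> {poly K}).
Hypothesis hkey : key_polynomials nu alpha Q.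
Variable b : Lam -> nat.

Implicit Types (i j l s : Lam) (f g : {poly K}) (v w : V) (c : {poly {poly K}}).

Local Notation ge := (pval_ge nu).
Local Notation gt := (pval_gt nu).
Local Notation eqv := (pval_eqv nu).
Local Notation small Q f := (size (f : {poly K}) < size (Q : {poly K}))%N.
Local Notation below l := ([set q : Lam | (q <= l)%O]).
Local Notation deg f := ((size (f : {poly K})).-1).

Lemma kp_monic i : Q i \is monic.
Proof. by have [[_ _ h _ _] _ _ _ _] := hkey. Qed.

Lemma kp_bot : Q \bot%O = 'X.
Proof. by have [[_ _ _ h _] _ _ _ _] := hkey. Qed.

Lemma kp_succ : successor_condition nu alpha Q.
Proof. by have [_ _ h _ _] := hkey. Qed.

Lemma kp_limit : limit_condition nu alpha Q.
Proof. by have [_ _ _ h _] := hkey. Qed.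

Lemma kp_deg_limit i i0 : i <> \bot%O -> ~ maximal_index i -> (i0 < i)%O ->
  is_plus alpha setT i0 i -> deg (Q i) = (alpha i * deg (Q i0))%N.
Proof. by have [[_ _ _ _ h] _ _ _ _] := hkey; exact: h. Qed.

Lemma kp_val i : eqv (Q i) (beta nu Q i).
Proof.
have [v hv] := pval_fin nu (monic_neq0 (kp_monic i)).
by rewrite /beta /pval_eqv hv.
Qed.

Definition free_small l := forall g : {fsfun Lam -> nat with 0%N},
  free_exponent alpha l g -> small (Q l) (expo_prod Q g).

Definition small_free_std l := forall f, small (Q l) f -> free_std_poly nu alpha Q l f.

(* [nu_i(f) = nu(f)] *)
Definition trunc_eq i f := forall v, ge v f -> lex nu (Q i) v 0 f.

(* [nu_i(f) < nu(f)] *)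
Definition trunc_lt i f := exists c v, [/\ f = c.[Q i],
  forall k, small (Q i) (c`_k)%R, forall k, ge v (c`_k * Q i ^+ k),
  exists k, eqv (c`_k * Q i ^+ k) v & gt v f].

Definition key_at l := exists eps, abstract_key nu (Q l) (beta nu Q l) eps (b l).

(** The first two clauses identify the polynomials of degree below [deg (Q l)] with the free
    standard expansions. They are asked for non-maximal [l], where the degree formula is given also
    at limits. *)
Definition inductive_property l :=
  [/\ ~ maximal_index l -> free_small l,
      ~ maximal_index l -> small_free_std l & key_at l].

Lemma ltn_not_maximal i l : (i < l)%O -> ~ maximal_index i.
Proof. by move=> il /(_ l); rewrite leNgt il. Qed.

Lemma monic_size_pos i : (0 < size (Q i))%N.
Proof. by rewrite size_poly_gt0 monic_neq0 ?kp_monic. Qed.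

Lemma small_free_std_poly l f : free_small l -> free_std_poly nu alpha Q l f ->
  small (Q l) f.
Proof.
move=> fs [s [hfree _] ->]; rewrite big_seq; apply: (big_ind (fun f => small (Q l) f)).
- by rewrite size_poly0 monic_size_pos.
- by move=> x y hx hy; rewrite (leq_ltn_trans (size_polyD _ _)) // gtn_max hx.
- by move=> m ms; apply: leq_ltn_trans (size_scale_leq _ _) (fs _ (hfree m ms)).
Qed.

Lemma trunc_eq_intro i f c : f = c.[Q i] -> (forall k, small (Q i) (c`_k)%R) ->
  (forall v, ge v f -> forall k, ge v (c`_k * Q i ^+ k)) -> trunc_eq i f.
Proof. by move=> fE hc h v hv; exists c; split=> // k; exact: h. Qed.

(** * Successor indices *)

Section Successor.
Variables (i l : Lam).
Hypothesis il : is_succ i l.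
Hypothesis fs : free_small i.

(** The relation satisfied by the initial form of [Q i] says that the class of [Q l] in degree
    [alpha l] times [beta i] vanishes, which is the strict inequality. *)
Lemma succ_expansion : exists a : nat -> {poly K},
  [/\ Q l = Q i ^+ alpha l + \sum_(k < alpha l) a k * Q i ^+ k,
      forall k, small (Q i) (a k),
      forall k, ge (beta nu Q i *+ alpha l) (a k * Q i ^+ k)
    & gt (beta nu Q i *+ alpha l) (Q l)].
Proof.
have [t [QE tfree tval [_ _ /rootP trel _]]] := kp_succ il.
pose a k := if (k < alpha l)%N then \sum_(m <- t k) monomial Q m else 0.
have Qi0 : Q i != 0 by rewrite monic_neq0 ?kp_monic.
have hQ : eqv (Q i ^+ alpha l) (beta nu Q i *+ alpha l) by exact/eqvX/kp_val.
have tge k m : (k < alpha l)%N -> m \in t k ->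
    eqv (monomial Q m * Q i ^+ k) (beta nu Q i *+ alpha l).
  by move=> kl mt; rewrite /pval_eqv tval.
have QE' : Q l = Q i ^+ alpha l + \sum_(k < alpha l) a k * Q i ^+ k.
  by rewrite QE; congr (_ + _); apply: eq_bigr => k _; rewrite /a ltn_ord.
have age k : ge (beta nu Q i *+ alpha l) (a k * Q i ^+ k).
  rewrite /a; case: ifP => kl; last by rewrite mul0r; exact: ge0.
  by rewrite mulr_suml big_seq; apply: ge_sum => m mt; apply/eqv_ge/tge.
exists a; split=> //.
  move=> k; rewrite /a; case: ifP => kl; last by rewrite size_poly0 monic_size_pos.
  by apply: small_free_std_poly => //; exists (t k) => //; exact: tfree.
have hge : ge (beta nu Q i *+ alpha l) (Q l).
  by rewrite QE'; apply: geD; [exact: eqv_ge | apply: ge_sum].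
apply/(cls_eq0 hge).
rewrite QE' clsD; [|exact: eqv_ge|exact: ge_sum].
rewrite cls_sum // -[RHS]trel hornerD hornerXn horner_sum -(gr_in_eqv hQ) gr_inX //.
congr (_ + _); apply: eq_bigr => k _; rewrite hornerZ hornerXn /a ltn_ord mulr_suml.
rewrite big_seq cls_sum => [|m mt]; last by apply/eqv_ge/tge.
rewrite -big_seq mulr_suml big_seq [RHS]big_seq; apply: eq_bigr => m mt.
have e := tge k m (ltn_ord k) mt; rewrite -(gr_in_eqv e).
have := eqv_neq0 e; rewrite mulf_eq0 negb_or => /andP[m0 Qk0].
rewrite gr_inM // gr_inX // monomialE; rewrite monomialE mulf_eq0 negb_or in m0.
by case/andP: m0 => m1 m2; rewrite gr_inM.
Qed.

Hypothesis Qi1 : (1 < size (Q i))%N.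

Lemma size_succ : deg (Q l) = (alpha l * deg (Q i))%N.
Proof.
have [a [QE sa _ _]] := succ_expansion.
have Qi0 : Q i != 0 by rewrite monic_neq0 ?kp_monic.
have sX n : size (Q i ^+ n) = (n * deg (Q i)).+1.
  have : (0 < size (Q i ^+ n))%N by rewrite size_poly_gt0 expf_neq0.
  by rewrite mulnC -size_exp; case: (size _).
rewrite QE size_polyDl ?sX //.
apply: (big_ind (fun f => (size (f : {poly K}) < (alpha l * deg (Q i)).+1)%N)).
- by rewrite size_poly0.
- by move=> x y hx hy; rewrite (leq_ltn_trans (size_polyD _ _)) // gtn_max hx.
move=> k _; apply: leq_ltn_trans (size_polyMleq _ _) _; rewrite sX.
have := sa k; have : (k.+1 * deg (Q i) <= alpha l * deg (Q i))%N.
  by rewrite leq_mul2r ltn_ord orbT.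
rewrite mulSn; move: (k * _)%N (alpha l * _)%N (size (a k)) => x y z.
by move: (size (Q i)) Qi1 => u; lia.
Qed.

Lemma succ_trunc_lt : trunc_lt i (Q l).
Proof.
have [a [QE sa age hgt]] := succ_expansion.
pose c : {poly {poly K}} := \poly_(k < (alpha l).+1) (if (k < alpha l)%N then a k else 1).
have cE k : c`_k = if (k < alpha l)%N then a k else if k == alpha l then 1 else 0.
  rewrite coef_poly ltnS leq_eqVlt; case: ltngtP => // _.
have hQ : eqv (Q i ^+ alpha l) (beta nu Q i *+ alpha l) by exact/eqvX/kp_val.
exists c, (beta nu Q i *+ alpha l); split=> //.
- rewrite horner_poly big_ord_recr /= ltnn mul1r addrC QE; congr (_ + _).
  by apply: eq_bigr => k _; rewrite ltn_ord.
- move=> k; rewrite cE; case: ifP => // _; case: ifP => _; first by rewrite size_poly1.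
  by rewrite size_poly0 monic_size_pos.
- move=> k; rewrite cE; case: ifP => // _; case: eqP => [->|_].
    by rewrite mul1r; exact: eqv_ge.
  by rewrite mul0r; exact: ge0.
- by exists (alpha l); rewrite cE ltnn eqxx mul1r.
Qed.

Hypothesis sfs : small_free_std i.

(** The [Q i]-expansion of [f] has at most [alpha l] terms. If the value of [f] exceeded their
    minimum, the initial forms would satisfy a relation of degree less than [alpha l]. *)
Lemma succ_trunc_eq f : small (Q l) f -> trunc_eq i f.
Proof.
move=> sf; have Qi0 : Q i != 0 by rewrite monic_neq0 ?kp_monic.
have [|c [fE hc sc]] := @expansion_exists _ (Q i) (alpha l) f (kp_monic i) Qi1.
  rewrite -size_succ -ltnS prednK // monic_size_pos //.
have [c0|c0] := eqVneq c 0.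
  apply: (trunc_eq_intro fE hc) => v _ k; rewrite c0 coef0 mul0r; exact: ge0.
have [w [hw1 hw2]] := expansion_min_value nu Qi0 c0.
have wE : eqv f w.
  have : ge w f by rewrite fE horner_coef; apply: ge_sum.
  case/ge_eqVgt => // hgt.
  have [t [_ _ _ trel]] := kp_succ il.
  pose A := smallest (@gr_subring _ _ nu)
    ([set gr_in nu (pfrac x%:P) | x in [set: K]] `|`
     [set gr_in nu (pfrac (Q q)) | q in [set q | (q < i)%O]]).
  have sA : gr_subring A.
    split.
    - by move=> B [[h1 _ _] _].
    - by move=> x y hx hy B hB; have [[_ h _] _] := hB; apply: h; [exact: hx | exact: hy].
    - by move=> x y hx hy B hB; have [[_ _ h] _] := hB; apply: h; [exact: hx | exact: hy].
  (* The subring sits in its graded fractions with denominator 1, homogeneous of degree 0. *)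
  have AS x : A x -> @gr_field_below _ _ nu _ _ Q i x.
    move=> hx; exists x, 1; split=> //; first by have [h1 _ _] := sA.
    - exact: oner_neq0.
    - by exists 0, 1; rewrite -(gr_in_eqv (pval1 nu)) gr_in1.
    - by rewrite mulr1.
  exfalso; move: hgt; rewrite fE.
  apply: (minimal_relation_ngt _ (kp_val i) trel) => //.
  - exact (AS _ (gr_subring0 sA)).
  - rewrite (leq_ltn_trans sc) // size_polyDl ?size_polyXn //.
    apply: (big_ind (fun f : {poly gr nu} => (size f < (alpha l).+1)%N)).
    + by rewrite size_poly0.
    + by move=> x y hx hy; rewrite (leq_ltn_trans (size_polyD _ _)) // gtn_max hx.
    + by move=> k _; rewrite (leq_ltn_trans (size_scale_leq _ _)) // size_polyXn ltnS ltn_ord.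
  - move=> k ck0; apply: AS.
    apply: (free_std_poly_gr_in kp_monic (sfs (hc k)) ck0) => //.
    + by move=> x B [_ hB]; apply: hB; left; exists x.
    + by move=> q qi B [_ hB]; apply: hB; right; exists q.
apply: (trunc_eq_intro fE hc) => v hv k; apply: ge_le (hw1 k).
by rewrite -(eqv_geE _ wE).
Qed.

End Successor.

End SuccessorStep.

(** * Key polynomials of a block, for successor and limit indices *)

Section Blocks.
Variables (K : fieldType) (V : ordQspaceType).
Variable nu : valuation {fraction {poly K}} V.
Context {d : Order.disp_t} {Lam : bOrderType d}.
Hypothesis wf : well_founded (fun i j : Lam => (i < j)%O).
Variables (alpha : Lam -> nat) (Q : Lam -> {poly K}).
Hypothesis hkey : key_polynomials nu alpha Q.
Variable b : Lam -> nat.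

Implicit Types (i j l s : Lam) (f g : {poly K}) (v w : V) (c : {poly {poly K}}).

Local Notation ge := (pval_ge nu).
Local Notation gt := (pval_gt nu).
Local Notation eqv := (pval_eqv nu).
Local Notation small Q f := (size (f : {poly K}) < size (Q : {poly K}))%N.
Local Notation deg f := ((size (f : {poly K})).-1).
Local Notation trunc_eq := (trunc_eq nu Q).
Local Notation trunc_lt := (trunc_lt nu Q).
Local Notation IH l := (forall i, (i < l)%O -> inductive_property nu alpha Q b i).

Lemma key_at_size i : key_at nu Q b i -> (1 < size (Q i))%N.
Proof. by case=> eps; exact: ak_size. Qed.

(** Common interface for successors and limits: the keys of the block have equal degree, all
    truncate [Q l] strictly, and each polynomial of smaller degree is truncated exactly from some
    index of the block on. *)
Record block_data (s l : Lam) : Prop := BlockData {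
  bd_block : block alpha s l;
  bd_size : forall j, (s <= j)%O -> (j < l)%O -> deg (Q j) = deg (Q s);
  bd_lt : forall j, (s <= j)%O -> (j < l)%O -> trunc_lt j (Q l);
  bd_deg : ~ maximal_index l -> deg (Q l) = (alpha l * deg (Q s))%N;
  bd_eq : forall f, small (Q l) f -> exists2 j, (s <= j < l)%O & trunc_eq j f;
  bd_mono : forall i j f, (s <= i)%O -> (i <= j)%O -> (j < l)%O ->
    trunc_eq i f -> trunc_eq j f
}.

Lemma block_data_succ s l : is_succ s l -> IH l -> block_data s l.
Proof.
move=> sl ih; have [hA hC hD] := ih s sl.1; have nm := ltn_not_maximal sl.1.
have js j : (s <= j)%O -> (j < l)%O -> j = s.
  by move=> sj jl; apply/eqP; rewrite eq_le sj (is_succ_le sl).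
have fs := hA nm; have Q1 := key_at_size hD.
split.
- exact: block_succ.
- by move=> j h1 h2; rewrite (js j h1 h2).
- by move=> j h1 h2; rewrite (js j h1 h2); exact: (succ_trunc_lt hkey sl fs).
- by move=> _; exact: (size_succ hkey sl fs).
- move=> f sf; exists s; first by rewrite lexx sl.1.
  exact: (succ_trunc_eq hkey sl fs Q1 (hC nm)).
- move=> i j f si ij jl; have sj := le_trans si ij.
  by rewrite (js j sj jl) (js i si (le_lt_trans ij jl)).
Qed.

Section Limit.
Variables (s l : Lam).
Hypothesis B : block alpha s l.
Hypothesis Bp : forall j, is_plus alpha setT j l <-> (s <= j)%O /\ (j < l)%O.
Hypothesis nsucc : ~ (exists i, is_succ i l).
Hypothesis ih : IH l.

Lemma limit_bot : l <> \bot%O.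
Proof. by move=> E; have := block_lt B; rewrite E ltx0. Qed.

Lemma limit_omega j : (s <= j)%O -> (j < l)%O ->
  inessential alpha setT j /\ is_shift_omega j l.
Proof.
move=> sj jl; have [_ [[h1 h2]|[_ h2]]] := proj2 (Bp j) (conj sj jl); first by split.
by case: nsucc; exists j.
Qed.

Lemma limit_step i i' : (s <= i)%O -> is_succ i i' -> (i' < l)%O ->
  [/\ alpha i' = 1%N, (s <= i')%O, (i < l)%O & deg (Q i') = deg (Q i)].
Proof.
move=> si ii' il'; have il : (i < l)%O := lt_trans ii'.1 il'.
have [[_ h] _] := limit_omega si il.
have a1 : alpha i' = 1%N by apply: (h 1%N); exists i.
split=> //; first exact: le_trans si (ltW ii'.1).
have [hA _ hD] := ih il; rewrite (size_succ hkey ii') ?a1 ?mul1n //.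
  exact/hA/(ltn_not_maximal il).
exact: key_at_size hD.
Qed.

(** Since [l = i0 + omega], the indices from [i0] up to [l] are finite shifts of [i0], and ordinary
    induction reaches them. *)
Lemma limit_ind (P : Lam -> Prop) i0 i1 : (s <= i0)%O -> (i0 <= i1)%O -> (i1 < l)%O ->
  P i0 -> (forall i i', (s <= i)%O -> is_succ i i' -> (i' < l)%O -> P i -> P i') ->
  P i1.
Proof.
move=> s0 i01 i1l P0 hP; have i0l := le_lt_trans i01 i1l.
have [_ o0] := limit_omega s0 i0l; have [t it] := omega_between o0 i01 i1l.
elim: t i1 it {i01} i1l => [|t IHt] i1 /=; first by move=> ->.
move=> [k ik ki1] i1l; have kl : (k < l)%O := lt_trans ki1.1 i1l.
apply: (hP k) => //; last exact: IHt.
exact: le_trans s0 (is_shift_le ik).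
Qed.

Lemma limit_size j : (s <= j)%O -> (j < l)%O -> deg (Q j) = deg (Q s).
Proof.
move=> sj jl.
apply: (limit_ind (P := fun j => deg (Q j) = deg (Q s)) (lexx s) sj jl) => //.
by move=> i i' si ii' il' <-; have [] := limit_step si ii' il'.
Qed.

(** As [alpha i' = 1], [Q i] is [Q i'] minus a small polynomial, both of value at least [beta i].
    Rewriting a [Q i]-expansion in powers of [Q i'] thus loses no value, the filtration of [Q i']
    being multiplicative. *)
Lemma limit_step_trunc_eq i i' f : (s <= i)%O -> is_succ i i' -> (i' < l)%O ->
  trunc_eq i f -> trunc_eq i' f.
Proof.
move=> si ii' il' hf v hv; have [a1 si' il degE] := limit_step si ii' il'.
have [hA _ hD] := ih il; have [_ _ [eps' key']] := ih il'.
have fs := hA (ltn_not_maximal il); have Q1 := key_at_size hD.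
have [a [QE sa age hgt]] := succ_expansion hkey ii' fs.
rewrite a1 mulr1n expr1 big_ord1 expr0 mulr1 in QE hgt age.
have sizeE : size (Q i) = size (Q i').
  have h1 := monic_size_pos hkey i; have h2 := monic_size_pos hkey i'.
  by rewrite -(prednK h1) -(prednK h2) degE.
have Qlex : lex nu (Q i') (beta nu Q i) 0 (Q i).
  have -> : Q i = Q i' - a 0%N by rewrite QE addrK.
  apply: lexD; last apply: lexN.
    rewrite -[X in lex _ _ _ _ X]mul1r -[X in _ * X]expr1; apply: (lex_term key') => //.
      by rewrite size_poly1 (ak_size key').
    by rewrite mul1r expr1; exact: gt_ge.
  apply: (lex_small key'); first by rewrite -sizeE.
  by have := age 0%N; rewrite expr0 mulr1.
have QXlex n : lex nu (Q i') (beta nu Q i *+ n) 0 (Q i ^+ n).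
  elim: n => [|n IHn].
    apply: (lex_small key'); first by rewrite expr0 size_poly1 (ak_size key').
    by rewrite expr0; exact/eqv_ge/pval1.
  rewrite exprS mulrS; exact: (lexM key' Qlex IHn).
have [c [-> hc h1 _]] := hf v hv; rewrite horner_coef.
apply: (lex_sum key') => k _; have [->|c0] := eqVneq (c`_k) 0.
  by rewrite mul0r; exact: (lex_zero key').
have [u hu] := pval_fin nu c0.
have su : small (Q i') (c`_k)%R by rewrite -sizeE.
have := lex_mul_small key' su (eqv_ge hu) (QXlex k).
apply: lex_le => //; rewrite -(eqv_geE _ (eqvM hu (eqvX k (kp_val hkey i)))).
exact: h1.
Qed.

Lemma limit_mono i j f : (s <= i)%O -> (i <= j)%O -> (j < l)%O ->
  trunc_eq i f -> trunc_eq j f.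
Proof.
move=> si ij jl hf.
apply: (limit_ind (P := fun j => trunc_eq j f) si ij jl) => // k k' sk kk' kl.
exact: limit_step_trunc_eq kk' kl.
Qed.

Lemma limit_std_expansion j f : (s <= j)%O -> (j < l)%O ->
  exists c, std_expansion nu alpha Q j f c.
Proof.
move=> sj jl; have [hA hC hD] := ih jl; have Q1 := key_at_size hD.
have [|c [fE hc _]] := @expansion_exists _ (Q j) (size f) f (kp_monic hkey j) Q1.
  by rewrite leq_pmulr // -ltnS prednK // (monic_size_pos hkey).
exists c; split=> // k; apply: hC; [exact: ltn_not_maximal jl | exact: hc].
Qed.

Lemma std_expansion_small j f c : (j < l)%O -> std_expansion nu alpha Q j f c ->
  forall k, small (Q j) (c`_k)%R.
Proof.
move=> jl [h _] k; have [hA _ _] := ih jl.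
exact: (small_free_std_poly hkey (hA (ltn_not_maximal jl)) (h k)).
Qed.

Lemma expansion_min_le j c k : vle (expansion_min nu Q j c) (pval nu (c`_k * Q j ^+ k)).
Proof.
have [kc|kc] := ltnP k (size c); last first.
  by rewrite nth_default // mul0r pval0; case: (expansion_min _ _ _ _).
exact: (vle_bigmin (fun n : 'I_(size c) => pval nu (c`_n * Q j ^+ n))
  (mem_index_enum (Ordinal kc))).
Qed.

Lemma limit_trunc_lt j : (s <= j)%O -> (j < l)%O -> trunc_lt j (Q l).
Proof.
move=> sj jl; have [_ _ hincr _ _] := kp_limit hkey limit_bot nsucc.
have [[c hc] hlt] := hincr j (proj2 (Bp j) (conj sj jl)).
have cs := std_expansion_small jl hc; have cE := hc.2.
have c0 : c != 0.
  apply: contraNneq (monic_neq0 (kp_monic hkey l)) => c0.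
  by rewrite cE c0 horner0.
have [v [h1 h2]] := expansion_min_value nu (monic_neq0 (kp_monic hkey j)) c0.
exists c, v; split=> //; rewrite /pval_gt; apply: vle_lt_trans (hlt c hc).
by apply: bigmin_glb => k _; exact: h1.
Qed.

(** If every index of the block truncated [f] strictly, [f] would compete with [Q l] in the
    minimality of its degree. *)
Lemma limit_trunc_eq f : small (Q l) f -> exists2 j, (s <= j < l)%O & trunc_eq j f.
Proof.
move=> sf; apply: contrapT => hN.
have [_ _ _ hmin _] := kp_limit hkey limit_bot nsucc.
suff : increases_truncations nu alpha Q l f by move=> /hmin; rewrite leqNgt sf.
move=> j /Bp[sj jl]; split; first exact: limit_std_expansion.
move=> c hc; apply: contrapT => /negP /negbNE hle; apply: hN; exists j.
  by rewrite sj jl.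
apply: (trunc_eq_intro hc.2); first exact: std_expansion_small hc.
move=> v hv k; apply: vle_trans hv _; apply: vle_trans hle _.
exact: expansion_min_le.
Qed.

Lemma block_data_limit : block_data s l.
Proof.
split=> //.
- exact: limit_size.
- exact: limit_trunc_lt.
- move=> nm; apply: (kp_deg_limit hkey limit_bot nm (block_lt B)).
  by apply/Bp; split; [exact: lexx | exact: block_lt B].
- exact: limit_trunc_eq.
- exact: limit_mono.
Qed.

End Limit.

Lemma block_data_exists l : l <> \bot%O -> IH l -> exists s, block_data s l.
Proof.
move=> lbot ih; have [[s sl]|nsucc] := pselect (exists s, is_succ s l).
  by exists s; exact: block_data_succ.
have [[s0 hs0] _ _ _ _] := kp_limit hkey lbot nsucc.
have [s [B Bp]] := block_limit wf hs0 nsucc.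
by exists s; exact: block_data_limit.
Qed.

End Blocks.

(** * The induction over the indices *)

Section Induction.
Variables (K : fieldType) (V : ordQspaceType).
Variable nu : valuation {fraction {poly K}} V.
Variable p : nat.
Hypothesis hp : char_exponent (residue_field nu) p.
Context {d : Order.disp_t} {Lam : bOrderType d}.
Hypothesis wf : well_founded (fun i j : Lam => (i < j)%O).
Variables (alpha : Lam -> nat) (Q : Lam -> {poly K}).
Hypothesis hkey : key_polynomials nu alpha Q.
Variable b : Lam -> nat.
Hypothesis hb : forall i, smallest_maximizer nu (Q i) (b i).

Implicit Types (i j l s : Lam) (f g : {poly K}) (v w : V) (c : {poly {poly K}}).

Local Notation ge := (pval_ge nu).
Local Notation gt := (pval_gt nu).
Local Notation eqv := (pval_eqv nu).
Local Notation small Q f := (size (f : {poly K}) < size (Q : {poly K}))%N.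
Local Notation deg f := ((size (f : {poly K})).-1).
Local Notation trunc_eq := (trunc_eq nu Q).
Local Notation trunc_lt := (trunc_lt nu Q).
Local Notation IH l := (forall i, (i < l)%O -> inductive_property nu alpha Q b i).

Lemma size_keyX i n : size (Q i ^+ n) = (n * deg (Q i)).+1.
Proof.
have : (0 < size (Q i ^+ n))%N.
  by rewrite size_poly_gt0 expf_neq0 // monic_neq0 ?(kp_monic hkey).
by rewrite mulnC -size_exp; case: (size _).
Qed.

Section Block.
Variables (s l : Lam).
Hypothesis B : block_data nu alpha Q s l.
Hypothesis ih : IH l.
Let bl := bd_block B.
Let sl := block_lt bl.

Lemma block_size j : (s <= j)%O -> (j < l)%O -> size (Q j) = size (Q s).
Proof.
move=> sj jl; have := bd_size B sj jl.
have h1 := monic_size_pos hkey j; have h2 := monic_size_pos hkey s.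
by rewrite -{2}(prednK h1) -{2}(prednK h2) => ->.
Qed.

(** Without its one index [j] in the block, the product has degree below [deg (Q s)]; the factor at
    [j] adds at most [alpha l - 1] times that degree. *)
Lemma block_free_small : ~ maximal_index l -> free_small alpha Q l.
Proof.
move=> nm g hg; have [j [sj jl gj hg']] := free_exponent_restrict bl hg.
pose g' := [fsfun g with j |-> 0%N].
have [hA _ _] := ih sl.
have hs : small (Q s) (expo_prod Q g').
  apply: hA; first exact: ltn_not_maximal sl.
  apply: hg'; first by rewrite /g' fsfun_with.
  by move=> i ij; rewrite /g' fsfun_withE (negbTE ij).
have -> : g = [fsfun g' with j |-> g j].
  apply/fsfunP => i; rewrite !fsfun_withE.
  by have [->|ij] := eqVneq i j; rewrite ?eqxx.
rewrite expo_prod_with /g' ?fsfun_with // -/g'.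
apply: leq_ltn_trans (size_polyMleq _ _) _; rewrite size_keyX (bd_size B) // addnS /=.
have h : ((g j).+1 * deg (Q s) <= alpha l * deg (Q s))%N by rewrite leq_mul2r gj orbT.
have := bd_deg B nm; have := monic_size_pos hkey l; have := monic_size_pos hkey s.
rewrite mulSn in h; move: h hs; move: (g j * _)%N (alpha l * _)%N (size (expo_prod _ _)).
by move=> x y z; move: (size (Q s)) (size (Q l)) => t u; lia.
Qed.

(** Expand [f] in a key [Q j] of the block with exact truncation, and the coefficients as free
    standard expansions at [s], by induction. *)
Lemma block_small_free_std : ~ maximal_index l -> small_free_std nu alpha Q l.
Proof.
move=> nm f sf; have [f0|f0] := eqVneq f 0.
  by exists [::]; rewrite ?big_nil //; split=> //; rewrite !big_nil pval0.
have [j /andP[sj jl] hf] := bd_eq B sf.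
have [hAs hCs hDs] := ih sl; have [_ _ [eps key]] := ih jl.
have [v hv] := pval_fin nu f0.
have [c [fE hc h1 _]] := hf v (eqv_ge hv).
have sjE := block_size sj jl; have Q1 := ak_size key.
(* This bounds the exponents of [Q j] by [alpha l - 1], as required of an [l]-standard exponent. *)
have sc : (size c <= alpha l)%N.
  have [|c' [fE' hc' sc']] := @expansion_exists _ (Q j) (alpha l) f (kp_monic hkey j) Q1.
    by rewrite (bd_size B) // -(bd_deg B nm) -ltnS prednK ?(monic_size_pos hkey).
  by rewrite (expansion_uniq (kp_monic hkey j) hc hc') // -fE.
have /choice[t ht] : forall k, exists t : seq (K * {fsfun Lam -> nat with 0%N}),
    free_std_expansion nu alpha Q s t /\ c`_k = \sum_(m <- t) monomial Q m.
  move=> k; have [|t h2 h3] := hCs (ltn_not_maximal sl) (c`_k); last by exists t.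
  by rewrite -sjE; exact: hc.
pose ext k (m : K * {fsfun Lam -> nat with 0%N}) := (m.1, [fsfun m.2 with j |-> k]).
(* Free exponents at [s] live strictly below [s], and [j >= s], so the slot [j] is vacant. *)
have mj k m : m \in t k -> m.2 j = 0%N.
  have [[hfree _] _] := ht k => mt; have [[hs _ _] ms] := hfree m mt.
  apply: contrapT => mj; have js := hs _ mj.
  by apply: mj; rewrite (_ : j = s) //; apply/eqP; rewrite eq_le js.
have monE k m : m \in t k -> monomial Q (ext k m) = monomial Q m * Q j ^+ k.
  move=> mt; rewrite /monomial /ext /= expo_prod_with ?(mj _ _ mt) //.
  by rewrite scalerAl.
pose L := [seq ext k m | k <- iota 0 (size c), m <- t k].
have LE : f = \sum_(m <- L) monomial Q m.
  rewrite /L big_allpairs_dep fE horner_coef -(big_mkord xpredT (fun k => c`_k * Q j ^+ k)).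
  rewrite /index_iota subn0; apply: eq_bigr => k _.
  have [_ ->] := ht k; rewrite mulr_suml big_seq [RHS]big_seq; apply: eq_bigr => m mt.
  by rewrite monE.
exists L => //; split.
  move=> _ /allpairsPdep[k [m [kc mt ->]]]; rewrite mem_iota add0n /= in kc.
  have [[hfree _] _] := ht k.
  apply: (free_exponent_extend bl sj jl (hfree m mt)) => /=.
    by rewrite fsfun_with; exact: leq_trans kc sc.
  by move=> i ij; rewrite fsfun_withE (negbTE ij).
rewrite -LE; apply: vle_anti; apply/andP; split; last first.
  by rewrite [in X in vle _ X]LE; apply: vle_sum => m mL; exact: vle_bigmin.
(* Neither the expansion of [f] in [Q j] nor those of its coefficients have a term of value below
   that of the sum. *)
apply: bigmin_glb => _ /allpairsPdep[k [m [kc mt ->]]]; rewrite monE //.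
rewrite hv; apply: (vle_trans (h1 k)); apply: vle_pvalM.
by have [[_ hval] hE] := ht k; rewrite hE hval; exact: vle_bigmin.
Qed.

(** Rules out a constant key polynomial: a monic constant is 1, whose only term has exactly the
    value of 1. *)
Lemma trunc_lt_size i f : key_at nu Q b i -> f \is monic -> trunc_lt i f ->
  (1 < size f)%N.
Proof.
move=> [eps key] fm [c [v [fE hc h1 [k hk] hgt]]].
rewrite ltnNge; apply/negP => /size1_polyC fC.
have f1 : f = 1.
  by move: (monicP fm); rewrite fC lead_coefC => ->.
have c1 : c = 1.
  apply: (expansion_uniq (kp_monic hkey i) hc); last by rewrite -fE f1 hornerC.
  move=> n; rewrite coef1; case: (n == 0%N); last by rewrite size_poly0 (monic_size_pos hkey).
  by rewrite size_poly1 (ak_size key).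
move: hk; rewrite c1 coef1; case: k => [|k] hk; last first.
  by have := eqv_neq0 hk; rewrite mul0r eqxx.
move: hk; rewrite expr0 mulr1 => hk; move: hgt; rewrite f1 => hgt.
by have := eqv_ngt hk; rewrite hgt.
Qed.

(** Only finitely many polynomials are involved, so the largest of their indices serves for all, by
    [bd_mono]. *)
Lemma block_common_trunc_eq f N : small (Q l) f ->
  exists2 j, (s <= j < l)%O & trunc_eq j f /\
    forall m, (0 < m <= N)%N -> trunc_eq j (Q l)^`N(m).
Proof.
move=> sf; elim: N => [|N [j /andP[sj jl] [h1 h2]]].
  by have [j jsl hj] := bd_eq B sf; exists j => //; split=> // -[|m].
have sN : small (Q l) ((Q l)^`N(N.+1))%R.
  by apply: size_nderivn_lt => //; rewrite monic_neq0 ?(kp_monic hkey).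
have [i /andP[si il] hi] := bd_eq B sN.
have [k [jk ik kl]] : exists k, [/\ (j <= k)%O, (i <= k)%O & (k < l)%O].
  by case: (leP i j) => ij; [exists j | exists i; split=> //; exact: ltW].
have mono i' f' : (s <= i')%O -> (i' <= k)%O -> trunc_eq i' f' -> trunc_eq k f'.
  by move=> h h'; exact: (bd_mono B h h' kl).
exists k; first by rewrite (le_trans sj jk).
split; first exact: mono h1.
move=> m /andP[m0]; rewrite leq_eqVlt => /orP[/eqP ->|mN]; first exact: mono hi.
by apply: (mono j) => //; apply: h2; rewrite m0.
Qed.

(** At an index [j] exact for [f] and for the derivatives of [Q l], the slopes of [f] are at most
    [eps'], the slope of [Q j]; and [eps' < eps] because [Q j] truncates [Q l] strictly. *)
Lemma block_key_at : key_at nu Q b l.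
Proof.
have [_ _ hDs] := ih sl.
have Ql1 := trunc_lt_size hDs (kp_monic hkey l) (bd_lt B (lexx s) sl).
have [eps [h1 h2 h3 h4 _]] :=
  smallest_maximizer_slope (kp_monic hkey l) Ql1 (hb l) (kp_val hkey l).
exists eps; split=> //; [exact: kp_monic hkey l | exact: kp_val hkey l |].
move=> f v n sf n0 hv.
have [j /andP[sj jl] [hf hder]] := block_common_trunc_eq (size (Q l)) sf.
have [_ _ [eps' key]] := ih jl.
have [c [u [cE hc hu hu' hgt]]] := bd_lt B sj jl.
have lt : qlt eps' eps.
  have hlt : qlt u (beta nu Q l) by rewrite -(eqv_gtE _ (kp_val hkey l)).
  apply: (key_slope_lt key hp cE hc hu hu' _ (kp_val hkey l) hlt h1).
  move=> m w m0 hw; have [mQ|mQ] := leqP m (size (Q l)).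
    by apply: hder hw; rewrite m0.
  by rewrite nderivn_poly0; [exact: (lex_zero key) | exact: ltnW].
apply: gt_lt (lex_ge_nderivn key n (hf v hv)).
by rewrite ![v + _]addrC qltD2r /qlt qleN2 qle_pMn.
Qed.

End Block.

Lemma free_exponent_bot (g : {fsfun Lam -> nat with 0%N}) :
  free_exponent alpha \bot%O g -> expo_prod Q g = 1.
Proof.
move=> [[h _ _] g0]; rewrite /expo_prod big_seq big1 // => i.
rewrite mem_finsupp => /eqP gi; case: (gi); have := h i gi.
by rewrite lex0 => /eqP ->.
Qed.

(** Here the key is ['X]: polynomials of smaller degree are constants, with vanishing derivatives of
    positive order. *)
Lemma inductive_property_bot : inductive_property nu alpha Q b \bot%O.
Proof.
have QE := kp_bot hkey; have Q1 : (1 < size (Q \bot%O))%N by rewrite QE size_polyX.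
split.
- by move=> _ g /free_exponent_bot ->; rewrite size_poly1.
- move=> _ f; rewrite QE size_polyX ltnS => /size1_polyC ->.
  pose m := (f`_0, [fsfun for fun=> 0%N] : {fsfun Lam -> nat with 0%N}).
  have mfree : free_exponent alpha \bot%O m.2.
    split; last by rewrite fsfun0E.
    split=> [i|i j|i k j j' _ _ _ _]; rewrite ?fsfun0E //.
    by rewrite ltx0.
  exists [:: m]; last by rewrite big_seq1 monomialE free_exponent_bot // mulr1.
  split; first by move=> m'; rewrite inE => /eqP ->.
  rewrite big_seq1 big_cons big_nil /vmin.
  by case: (pval _ _).
have [eps [h1 h2 h3 h4 _]] :=
  smallest_maximizer_slope (kp_monic hkey \bot%O) Q1 (hb \bot%O) (kp_val hkey \bot%O).
exists eps; split=> //; [exact: kp_monic hkey _ | exact: kp_val hkey _ |].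
move=> f v n; rewrite QE size_polyX ltnS => /size1_polyC -> n0 _.
by rewrite nderivnC gtn_eqF //; exact: gt0.
Qed.

Lemma kp_inductive_property l : inductive_property nu alpha Q b l.
Proof.
elim/(well_founded_ind wf): l => l ih.
have [->|lbot] := pselect (l = \bot%O); first exact: inductive_property_bot.
have [s B] := block_data_exists wf hkey lbot ih.
split; [exact: block_free_small B ih | exact: block_small_free_std B ih |].
exact: block_key_at B ih.
Qed.

End Induction.

(** * Maximizers of the slopes are powers of the characteristic exponent *)

Theorem corollary7p9 (K : fieldType) (V : ordQspaceType)
  (nu : valuation {fraction {poly K}} V)
  (hV : rational_hull nu)
  (hrank : rank_nuK_eq1 nu)
  (hx : vlt 0%:E (pval nu 'X))
  (p : nat) (hp : char_exponent (residue_field nu) p)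
  (d : Order.disp_t) (Lam : bOrderType d)
  (hwf : well_founded (fun i j : Lam => (i < j)%O))
  (hcount : countable [set: Lam])
  (alpha : Lam -> nat) (Q : Lam -> {poly K})
  (hkey : key_polynomials nu alpha Q)
  (hcomplete : complete_family nu Q)
  (b : Lam -> nat) (hb : forall i, smallest_maximizer nu (Q i) (b i)) :
  forall i,
    [/\ forall b', I_max nu (Q i) (b i) b' -> exists e : nat, b' = (p ^ e)%N,
        exists e : nat, b i = (p ^ e)%N
      & [pchar (residue_field nu)] =i pred0 ->
        [/\ p = 1%N, I_max nu (Q i) (b i) = [set b i] & b i = 1%N]].
Proof.
move=> i; have [_ _ [eps key]] := kp_inductive_property hp hwf hkey hb i.
have [eps' [h1 _ h3 _ hI]] :=
  smallest_maximizer_slope (ak_monic key) (ak_size key) (hb i) (ak_val key).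
(* Both slopes are determined by the value of the derivative of order [b i > 0]. *)
have epsE : eps' = eps.
  have := eqv_inj (ak_eqv key) h3 => /addrI /oppr_inj E.
  apply: qle_anti; rewrite -(qle_pMn eps' eps (ak_q0 key)).
  by rewrite -(qle_pMn eps eps' (ak_q0 key)) E qle_refl.
have pow n : I_max nu (Q i) (b i) n -> exists e, n = (p ^ e)%N.
  by move=> /hI[n0 hn]; apply: (maximizer_expn key hp n0); rewrite -epsE.
have powb : exists e, b i = (p ^ e)%N by apply: pow; split=> //; exact: ak_q0 key.
(* With [p = 1] every power of [p] is 1, so the set of maximizers has one element. *)
split=> // p0; have p1 : p = 1%N by case: hp => [|[]//]; rewrite p0.
have [e be] := powb; rewrite p1 exp1n in be.
split=> //; apply/seteqP; split=> n /=; last by move=> ->; split=> //; exact: ak_q0 key.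
by move=> /pow[e' ->]; rewrite p1 exp1n be.
Qed.
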